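(* Let $\mathcal P\subset\mathcal F\{x_1,x_2,x_3\}$ be a prime differential ideal of differential dimension $0$. Assume that there exist natural numbers $a_1>b>c\ge0$ and $a_2,a_3$ such that: (a) $\operatorname{orders}\mathcal P$ contains $(a_1,a_2,a_3)$, $(b,a_2+a_1-b,a_3)$ and $(c,a_2,a_3+a_1-c)$, and contains no element $(d_1,d_2,a_3)$ with $a_1>d_1>b$ and no element $(d_1,a_2,d_3)$ with $a_1>d_1>c$; (b) $\operatorname{orders}\mathcal P$ does not contain any $(d_1,d_2,a_3)$ with $b>d_1\ge c$; (c) $\operatorname{orders}\mathcal P$ does not contain any $(a_1,e_2,e_3)$ with $a_2>e_2$ nor any $(f_1,f_2,a_3)$ with $a_2>f_2$. Then $\operatorname{orders}\mathcal P$ contains $(c,a_2+a_1-b,a_3+b-c)$.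
   Context: $\mathcal F$ is an ordinary differential field of characteristic $0$. For a prime differential ideal $\mathcal P\subset\mathcal F\{x_1,\dots,x_n\}$ of differential dimension $0$ and a characteristic set $\mathcal A=\{A_1,\dots,A_n\}$ of $\mathcal P$ (in the sense of Ritt, for some ordering (ranking) on derivatives), numbered so that the main derivative of $A_j$ is a derivative of $x_j$, put $\operatorname{orders}\mathcal A=(\mathrm{ord}_{x_1}A_1,\dots,\mathrm{ord}_{x_n}A_n)$. Then $\operatorname{orders}\mathcal P=\{\operatorname{orders}\mathcal A\mid\mathcal A\text{ a characteristic set of }\mathcal P\text{ for some ordering}\}$. *)

(* Defs.v *)
From HB Require Import structures.
From mathcomp Require Import all_boot all_order all_algebra.
From mathcomp Require Import finmap.
From mathcomp.multinomials Require Import monalg.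

Set Implicit Arguments.
Unset Strict Implicit.
Unset Printing Implicit Defensive.

Import GRing.Theory.

Local Open Scope fset_scope.
Local Open Scope ring_scope.

Definition derivation (R : pzRingType) (d : R -> R) : Prop :=
  (forall x y, d (x + y) = d x + d y) /\
  (forall x y, d (x * y) = d x * y + x * d y).

(* The derivative x_j^(k) is the pair (j, k), with j counted from 0.  The ring
   F{x_1, .., x_n} is the polynomial ring over F in these indeterminates. *)
Notation dvar n := ('I_n * nat)%type.
Notation diffpoly F n := {malg F[{cmonom (dvar n)}]}.

Definition dnext n (v : dvar n) : dvar n := (v.1, v.2.+1).

Section DiffPoly.
Context (F : fieldType) (n : nat).
Implicit Types (p q : diffpoly F n) (m : {cmonom (dvar n)}) (v : dvar n).
Implicit Types (r : rel (dvar n)) (s t : seq (diffpoly F n)).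
Implicit Types (P : diffpoly F n -> Prop).

(* Leibniz rule on a monomial: each v in m contributes m(v) (m / v) v'. *)
Definition dmonom m : diffpoly F n :=
  \sum_(v <- finsupp m)
    << (m v)%:R *g mmul (divcm m (ucm v)) (ucm (dnext v)) >>.

(* The derivation of F{x_1, .., x_n} extending delta with (x_j^(k))' = x_j^(k+1). *)
Definition dpoly (delta : F -> F) p : diffpoly F n :=
  \sum_(m <- msupp p) (<< delta p@_m *g m >> + p@_m *: dmonom m).

Definition dvars p : {fset dvar n} := \bigcup_(m <- msupp p) finsupp m.

Definition degv v p : nat := \max_(m <- msupp p) m v.

(* ord_{x_j} p; by convention 0 if no derivative of x_j occurs in p. *)
Definition ordx (j : 'I_n) p : nat := \max_(v <- dvars p | v.1 == j) v.2.

Definition diff_ideal (delta : F -> F) P : Prop :=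
  [/\ P 0, forall p q, P p -> P q -> P (p + q),
      forall p q, P q -> P (p * q) & forall p, P p -> P (dpoly delta p)].

Definition prime_diff_ideal (delta : F -> F) P : Prop :=
  [/\ diff_ideal delta P, ~ P 1 & forall p q, P (p * q) -> P p \/ P q].

Definition independent P (U : {set 'I_n}) : Prop :=
  forall p, P p -> (forall v, v \in dvars p -> v.1 \in U) -> p = 0.

(* Ritt's dimension of a prime differential ideal: the largest number of
   indeterminates among x_1, .., x_n that are differentially independent
   modulo P. *)
Definition diff_dim P (d : nat) : Prop :=
  (exists U : {set 'I_n}, independent P U /\ #|U| = d) /\
  (forall U : {set 'I_n}, independent P U -> #|U| <= d)%N.

Definition ranking r : Prop :=
  [/\ total r, antisymmetric r, transitive r,
      forall v, r v (dnext v) &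
      forall u v, r u v -> r (dnext u) (dnext v)].

(* v is the main derivative (leader) of p; elements of F have none. *)
Definition leader r p v : bool :=
  (v \in dvars p) && all (r^~ v) (dvars p).

Definition reduced r p q : Prop :=
  forall j k, leader r q (j, k) ->
    (forall l, (k < l)%N -> (j, l) \notin dvars p) /\
    (degv (j, k) p < degv (j, k) q)%N.

Definition lower_leader r p q : Prop :=
  exists u v, [/\ leader r p u, leader r q v, u != v & r u v].

Definition lower_rank r p q : Prop :=
  lower_leader r p q \/
  exists u, [/\ leader r p u, leader r q u & (degv u p < degv u q)%N].

Definition same_rank r p q : Prop :=
  exists u, [/\ leader r p u, leader r q u & degv u p = degv u q].

(* Autoreduced set (Ritt's ascending set), listed by increasing leaders. *)
Definition autoreduced r s : Prop :=
  [/\ forall p, p \in s -> exists v, leader r p v,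
      forall p q, p \in s -> q \in s -> p != q -> reduced r p q &
      forall i j, (i < j < size s)%N -> lower_leader r s`_i s`_j].

(* Comparison of autoreduced sets; a proper extension of t is lower than t. *)
Fixpoint lower_set r s t : Prop :=
  match s, t with
  | p :: s', q :: t' =>
      lower_rank r p q \/ (same_rank r p q /\ lower_set r s' t')
  | _ :: _, [::] => True
  | [::], _ => False
  end.

Definition char_set r P s : Prop :=
  [/\ autoreduced r s, forall p, p \in s -> P p &
      forall t, autoreduced r t -> (forall p, p \in t -> P p) ->
        ~ lower_set r t s].

(* The set "orders P": A is a characteristic set numbered so that the main
   derivative of A j is a derivative of x_j. *)
Definition orders P (o : n.-tuple nat) : Prop :=
  exists r, ranking r /\
  exists A : 'I_n -> diffpoly F n,
    [/\ exists s, char_set r P s /\ perm_eq s (codom A),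
        forall j, exists k, leader r (A j) (j, k) &
        forall j, tnth o j = ordx j (A j)].

End DiffPoly.

(* Main.v *)
Require Import Defs.
From HB Require Import structures.
From mathcomp Require Import all_boot all_order all_algebra.
From mathcomp Require Import generic_quotient ring_quotient fraction.
From mathcomp Require Import finmap boolp ring zify.
From mathcomp.multinomials Require Import monalg.

(* Let K be the fraction field of F{x_1, .., x_n} / P.  Call a K-valued
   F-derivation of F{x_1, .., x_n} that kills P a tangent vector, and say that a
   derivative v lies in the closure of a set B when every tangent vector that
   vanishes on B vanishes at v, i.e. when dv is in the K-span of dB in the module
   of differentials of K over F.  This is the closure operator of a matroid,
   and, since commutators with the derivation are again tangent vectors, it is
   compatible with derivation.

   A tuple o is in orders P iff the derivatives x_j^(k), k < o_j, form a basis of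
   this matroid: since P has no nonzero element reduced with respect to a
   characteristic set, and its separants are not in P, they form a
   transcendence basis, whose differentials form a basis as the characteristic
   is 0; conversely, for a basis o, the ranking that compares k - o_j has a
   characteristic set with leaders x_j^(o_j).

   The minimality hypotheses on a_2 force x_1^(a1) and x_3^(a3) into the closure
   of {x_1^(k), k < a1} and {x_3^(k), k < a3}.  Let x_1^(l) be the highest
   derivative of x_1 needed for x_3^(a3).  Exchanging the two and differentiating,
   x_1^(l + i) is in the closure of {x_1^(k), k < l} and {x_3^(k), k <= a3 + i},
   so (l, a2, a3 + a1 - l) is in orders P, and l = c.  Hence in the basis
   (b, a2 + a1 - b, a3) the derivatives x_1^(c), .., x_1^(b-1) can be traded for
   x_3^(a3), .., x_3^(a3 + b - c - 1). *)

Set Implicit Arguments.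
Unset Strict Implicit.
Unset Printing Implicit Defensive.

Import GRing.Theory.

Local Open Scope ring_scope.

(** * The residue field of a prime ideal *)

Section ResidueField.
Local Open Scope quotient_scope.
Context (R : comNzRingType) (I : prime_idealr R).

Definition residue_ring := {ideal_quot I}.

HB.instance Definition _ := GRing.ComNzRing.on residue_ring.

(** Units and inverses of the quotient are chosen classically: the field of fractions is built over
    a domain that carries an inverse operation. *)
Definition residue_unit : pred residue_ring :=
  fun x => `[<exists y, y * x = 1>].

Definition residue_inv (x : residue_ring) : residue_ring :=
  if pselect (exists y, y * x = 1) is left h then projT1 (cid h) else x.

Lemma residue_mulVx : {in residue_unit, left_inverse 1 residue_inv *%R}.
Proof.
move=> x /asboolP h; rewrite /residue_inv; case: pselect => // h'.
by case: (cid h').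
Qed.

Lemma residue_unitPl (x y : residue_ring) : y * x = 1 -> residue_unit x.
Proof. by move=> yx; apply/asboolP; exists y. Qed.

Lemma residue_inv_out : {in [predC residue_unit], residue_inv =1 id}.
Proof.
move=> x; rewrite !inE => /asboolPn h; rewrite /residue_inv.
by case: pselect => // h'; case: (h h').
Qed.

HB.instance Definition _ := GRing.ComNzRing_hasMulInverse.Build residue_ring
  residue_mulVx residue_unitPl residue_inv_out.
HB.instance Definition _ := GRing.ComUnitRing_isIntegral.Build residue_ring
  (@Quotient.rquot_IdomainAxiom _ I).

Lemma residue_field_exists :
  exists (K : fieldType) (phi : {rmorphism R -> K}),
    (forall p, (phi p == 0) = (p \in I)) /\
    (forall z, exists a b, phi b != 0 /\ z = phi a / phi b).
Proof.
pose pi : {rmorphism R -> residue_ring} := \pi_{ideal_quot I}.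
pose phi : {rmorphism R -> {fraction residue_ring}} :=
  @tofrac residue_ring \o pi.
exists {fraction residue_ring}, phi; split=> [p | z].
  by rewrite /phi /= tofrac_eq0 -(rmorph0 pi) -Quotient.idealrBE subr0.
elim/quotW: z => z.
exists (repr (\n_z)), (repr (\d_z)); rewrite /phi /pi /= !reprK.
have dz : tofrac (\d_z) != 0 by rewrite tofrac_eq0 denom_ratioP.
split=> //; apply/(canRL (mulfK dz)).
rewrite !piE; apply/eqP; rewrite piE FracField.equivfE /FracField.mulf /=.
have -> : \pi_{ideal_quot I} 1 = 1 :> residue_ring by exact: (rmorph1 pi).
rewrite !numden_Ratio ?oner_eq0 ?mulr1 ?mul1r ?denom_ratioP //.
by rewrite mulrC.
Qed.
End ResidueField.

(** The ideal is a Prop-valued predicate, so it is first made boolean classically; of the residue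
    field only the kernel of [phi] and the fraction form of its elements are kept. *)
Lemma prime_residue_field (R : comNzRingType) (P : R -> Prop) :
  P 0 -> (forall p q, P p -> P q -> P (p + q)) ->
  (forall p q, P q -> P (p * q)) -> ~ P 1 ->
  (forall p q, P (p * q) -> P p \/ P q) ->
  exists (K : fieldType) (phi : {rmorphism R -> K}),
    (forall p, phi p = 0 <-> P p) /\
    (forall z, exists a b, phi b != 0 /\ z = phi a / phi b).
Proof.
move=> P0 PD PM P1 Pprime.
pose S : R -> bool := fun p => `[<P p>].
have S_ideal : idealr_closed S.
  split; [exact/asboolP | exact/asboolP |].
  by move=> a u v /asboolP Pu /asboolP Pv; apply/asboolP/PD => //; apply: PM.
have S_prime : prime_idealr_closed S.
  by move=> u v /asboolP /Pprime[] h; apply/orP; [left|right]; apply/asboolP.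
pose I1 := isIdealr.Build R S S_ideal.
pose I2 := isPrimeIdealrClosed.Build R S S_prime.
pose I : prime_idealr R := HB.pack S I1 I2.
have [K [phi [phi0 frac]]] := residue_field_exists I.
exists K, phi; split=> // p; split=> [/eqP|Pp].
  by rewrite phi0 => /asboolP.
by apply/eqP; rewrite phi0; apply/asboolP.
Qed.

Lemma ex_min_nat (Q : nat -> Prop) : (exists k, Q k) ->
  exists2 k, Q k & forall l, Q l -> (k <= l)%N.
Proof.
move=> [k Qk]; have ex : exists k, `[<Q k>] by exists k; apply/asboolP.
case: (ex_minnP ex) => l /asboolP Ql min_l; exists l => // j Qj.
by apply: min_l; apply/asboolP.
Qed.

(** * Passage of a derivation to the field of fractions *)

Section FractionDerivation.
Context (R : comNzRingType) (K : fieldType) (phi : {rmorphism R -> K}).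
Context (D : R -> R).
Hypotheses (DD : forall p q, D (p + q) = D p + D q).
Hypotheses (DM : forall p q, D (p * q) = D p * q + p * D q).
Hypothesis D_ker : forall p, phi p = 0 -> phi (D p) = 0.
Hypothesis frac : forall z, exists a b, phi b != 0 /\ z = phi a / phi b.

(** The quotient rule: at z = phi a / phi b the value is (phi (D a) - z phi (D b)) / phi b, which is
    independent of a and b because [D] preserves the kernel of [phi]. *)
Lemma derivation_on_fractions : exists d : K -> K,
  [/\ forall y z, d (y + z) = d y + d z,
      forall y z, d (y * z) = d y * z + y * d z &
      forall p, d (phi p) = phi (D p)].
Proof.
have DN p : D (- p) = - D p.
  have D0 : D 0 = 0 by apply: (addrI (D 0)); rewrite -DD !addr0.
  by apply/eqP; rewrite -addr_eq0 -DD addNr D0.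
have /choice[g gP] : forall z, exists ab, phi ab.2 != 0 /\ z * phi ab.2 = phi ab.1.
  by move=> z; have [a [b [b0 ->]]] := frac z; exists (a, b); rewrite divfK.
pose d z := (phi (D (g z).1) - z * phi (D (g z).2)) / phi (g z).2.
have dE z a b : phi b != 0 -> z * phi b = phi a ->
    d z * phi b = phi (D a) - z * phi (D b).
  move=> b0 zb; have [b0' zb'] := gP z; rewrite /d.
  move: (g z).1 (g z).2 b0' zb' => a' b' b0' zb'.
  apply: (mulIf b0'); rewrite mulrAC divfK //.
  (* For two representations of z the element a b' - a' b lies in the kernel, hence so does its
     derivative; expanding it compares the two quotient rules. *)
  have: phi (D (a * b' - a' * b)) = 0.
    by apply: D_ker; rewrite rmorphB !rmorphM -zb -zb'; ring.
  rewrite DD DN !DM rmorphB !rmorphD !rmorphM -zb -zb' => /eqP.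
  rewrite subr_eq0 => /eqP e.
  apply/eqP; rewrite -subr_eq0; apply/eqP.
  transitivity (phi (D a') * phi b + z * phi b' * phi (D b) -
    (phi (D a) * phi b' + z * phi b * phi (D b'))); first by ring.
  by rewrite e subrr.
exists d; split=> [y z|y z|p].
- have [[b0 yb] [c0 zc]] := (gP y, gP z).
  move: (dE y _ _ b0 yb) (dE z _ _ c0 zc).
  move: (g y).1 (g y).2 (g z).1 (g z).2 b0 yb c0 zc => a b a' c b0 yb c0 zc ey ez.
  have bc0 : phi (b * c) != 0 by rewrite rmorphM mulf_neq0.
  apply: (mulIf bc0); rewrite (dE _ (a * c + a' * b)) //; last first.
    by rewrite rmorphD !rmorphM -yb -zc; ring.
  rewrite DD !DM !rmorphD !rmorphM -yb -zc.
  transitivity (d y * phi b * phi c + d z * phi c * phi b); last by ring.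
  by rewrite ey ez; ring.
- have [[b0 yb] [c0 zc]] := (gP y, gP z).
  move: (dE y _ _ b0 yb) (dE z _ _ c0 zc).
  move: (g y).1 (g y).2 (g z).1 (g z).2 b0 yb c0 zc => a b a' c b0 yb c0 zc ey ez.
  have bc0 : phi (b * c) != 0 by rewrite rmorphM mulf_neq0.
  apply: (mulIf bc0); rewrite (dE _ (a * a')) //; last first.
    by rewrite !rmorphM -yb -zc; ring.
  rewrite !DM !rmorphD !rmorphM -yb -zc.
  transitivity (d y * phi b * z * phi c + y * phi b * (d z * phi c)); last by ring.
  by rewrite ey ez; ring.
- have D1 : D 1 = 0.
    by apply: (addrI (D 1)); have := DM 1 1; rewrite !mulr1 mul1r addr0 => <-.
  have := dE (phi p) p 1; rewrite rmorph1 !mulr1 D1 rmorph0 mulr0 subr0; apply=> //.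
  exact: oner_neq0.
Qed.
End FractionDerivation.

(** * Extension of derivations *)

Section Along.
Context (F : Type) (R S : comNzRingType) (C : F -> R) (phi : {rmorphism R -> S}).

Definition der_along (E : R -> S) : Prop :=
  [/\ forall p q, E (p + q) = E p + E q,
      forall p q, E (p * q) = E p * phi q + phi p * E q &
      forall c, E (C c) = 0].
End Along.

Section Ext.
Context (F : nzRingType) (V : countType) (R : comNzRingType) (K : fieldType).
Context (x : V -> R) (C : F -> R) (phi : {rmorphism R -> K}).
Hypotheses (CD : forall c c', C (c + c') = C c + C c').
Hypotheses (C1 : C 1 = 1).
Hypothesis charK : forall n, (n.+1)%:R != 0 :> K.

Implicit Types (X B : V -> Prop) (p q : R) (v : V).

Inductive gen X : R -> Prop :=
| gen_C c : gen X (C c)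
| gen_X v : X v -> gen X (x v)
| gen_D p q : gen X p -> gen X q -> gen X (p + q)
| gen_M p q : gen X p -> gen X q -> gen X (p * q).

Lemma gen_sub X Y p : (forall v, X v -> Y v) -> gen X p -> gen Y p.
Proof.
move=> XY; elim=> [c|v /XY|a b _ ? _ ?|a b _ ? _ ?];
  [exact: gen_C|exact: gen_X|exact: gen_D|exact: gen_M].
Qed.

Lemma gen_0 X : gen X 0.
Proof.
have -> : 0 = C 0; last exact: gen_C.
by apply: (addrI (C 0)); rewrite -CD !addr0.
Qed.

Lemma gen_N X p : gen X p -> gen X (- p).
Proof.
move=> Xp; rewrite -mulN1r; apply: gen_M => //.
have -> : -1 = C (-1); last exact: gen_C.
apply: (addrI 1); rewrite subrr -{1}C1 -CD subrr.
by apply: (addrI (C 0)); rewrite -CD !addr0.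
Qed.

Lemma gen_Mn X p k : gen X p -> gen X (p *+ k).
Proof.
move=> Xp; elim: k => [|k IH]; first by rewrite mulr0n; apply: gen_0.
by rewrite mulrS; apply: gen_D.
Qed.

Local Notation der_along := (der_along C phi).

Lemma der_along0 E : der_along E -> E 0 = 0.
Proof. by case=> ED _ _; apply: (addrI (E 0)); rewrite -ED !addr0. Qed.

Lemma der_alongN E p : der_along E -> E (- p) = - E p.
Proof.
move=> Ed; apply/eqP; rewrite -addr_eq0.
by case: (Ed) => <- _ _; rewrite addNr der_along0.
Qed.

Lemma der_gen_eq E E' X p : der_along E -> der_along E' ->
  (forall v, X v -> E (x v) = E' (x v)) -> gen X p -> E p = E' p.
Proof.
move=> [ED EM EC] [ED' EM' EC'] EE'.
elim=> [c|v /EE'//|a b _ Ea _ Eb|a b _ Ea _ Eb].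
- by rewrite EC EC'.
- by rewrite ED ED' Ea Eb.
- by rewrite EM EM' Ea Eb.
Qed.

Lemma der_gen0 E X p : der_along E ->
  (forall v, X v -> E (x v) = 0) -> gen X p -> E p = 0.
Proof.
move=> Ed E0; apply: (der_gen_eq (E' := fun=> 0)) => //.
by split=> *; rewrite ?addr0 ?mul0r ?mulr0 ?addr0.
Qed.

Lemma gen_poly X v p : gen (fun w => X w \/ w = v) p ->
  exists2 f : {poly R}, (forall i, gen X f`_i) & p = f.[x v].
Proof.
elim=> [c|w [Xw|->]|a b _ [f fX ->] _ [g gX ->]|a b _ [f fX ->] _ [g gX ->]].
- exists (C c)%:P; last by rewrite hornerC.
  by move=> i; rewrite coefC; case: eqP => _; [apply: gen_C|apply: gen_0].
- exists (x w)%:P; last by rewrite hornerC.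
  by move=> i; rewrite coefC; case: eqP => _; [apply: gen_X|apply: gen_0].
- exists 'X; last by rewrite hornerX.
  move=> i; rewrite coefX; case: eqP => _; last exact: gen_0.
  by rewrite -C1; apply: gen_C.
- exists (f + g); last by rewrite hornerD.
  by move=> i; rewrite coefD; apply: gen_D.
- exists (f * g); last by rewrite hornerM.
  move=> i; rewrite coefM; elim/big_ind: _ => [|? ? ? ?|j _]; first exact: gen_0.
  + exact: gen_D.
  + exact: gen_M.
Qed.

Lemma der_horner E (f : {poly R}) a : der_along E -> (forall i, E f`_i = 0) ->
  E f.[a] = phi f^`().[a] * E a.
Proof.
move=> Ed; have [ED EM _] := Ed.
elim/poly_ind: f => [|f c IH] f0.
  by rewrite horner0 der_along0 // deriv0 horner0 rmorph0 mul0r.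
have Ec : E c = 0 by have := f0 0%N; rewrite coefD coefMX coefC add0r.
have {}IH : E f.[a] = phi f^`().[a] * E a.
  by apply: IH => i; have := f0 i.+1; rewrite coefD coefMX coefC addr0.
rewrite hornerMXaddC ED EM Ec addr0 IH derivD derivC addr0 derivM derivX mulr1.
by rewrite hornerD hornerMX rmorphD rmorphM; ring.
Qed.

Hypothesis der_exists : forall lam : V -> K,
  exists2 E, der_along E & forall v, E (x v) = lam v.

(** This is the condition for [E] to induce a derivation on the image in [K] of the subring
    generated by X. *)
Definition kills (E : R -> K) X := forall p, gen X p -> phi p = 0 -> E p = 0.

(** Adjunction of one element in characteristic 0. If [x v] is transcendental over the image of
    [gen X], any value at v is admissible; if it is algebraic, a polynomial of minimal degree is
    separable and determines the value. *)
Lemma der_extend1 X v E : ~ X v -> der_along E -> kills E X ->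
  exists E', [/\ der_along E', forall w, X w -> E' (x w) = E (x w) &
    kills E' (fun w => X w \/ w = v)].
Proof.
move=> Xv Ed EX.
pose Xpoly (f : {poly R}) := (forall i, gen X f`_i) /\ phi f.[x v] = 0.
pose Q k := exists f, [/\ Xpoly f, phi (lead_coef f) != 0 & size f = k].
have agree E' : der_along E' -> (forall w, X w -> E' (x w) = E (x w)) -> kills E' X.
  move=> Ed' eqE p Xp p0.
  by rewrite (der_gen_eq Ed' Ed eqE Xp); apply: EX.
(* A tangent value at v is admissible as soon as it kills one polynomial of
   minimal degree over X: all others reduce to it by pseudo-division. *)
have reduce E' (q : {poly R}) : der_along E' -> kills E' X ->
    (Q (size q) /\ Xpoly q /\ phi (lead_coef q) != 0 /\ E' q.[x v] = 0 \/ q = 0) ->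
    (forall k, Q k -> q != 0 /\ (size q <= k)%N) ->
    forall f, Xpoly f -> E' f.[x v] = 0.
  move=> Ed' E'X hq qmin f; have [ED EM _] := Ed'.
  have [k] := ubnP (size f); elim: k f => // k IH f fk [fX f0].
  have [->|f_neq0] := eqVneq f 0; first by rewrite horner0 der_along0.
  (* A leading coefficient in the kernel of [phi] is killed by [E'] too, so the leading term
     contributes nothing and is dropped. *)
  have [lf0|lf0] := eqVneq (phi (lead_coef f)) 0.
    pose g := f - lead_coef f *: 'X^((size f).-1).
    have gX i : gen X g`_i.
      rewrite coefB coefZ coefXn; apply: gen_D => //; apply: gen_N.
      by rewrite mulr_natr; apply: gen_Mn; apply: fX.
    have fE : f.[x v] = g.[x v] + lead_coef f * x v ^+ (size f).-1.
      by rewrite hornerD hornerN hornerZ hornerXn subrK.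
    have g0 : phi g.[x v] = 0.
      by move: f0; rewrite fE rmorphD rmorphM lf0 mul0r addr0.
    have sg : (size g < k)%N.
      apply: (leq_trans _ (fk : (size f <= k)%N)).
      have sf : size f = (size f).-1.+1 by rewrite prednK // size_poly_gt0.
      rewrite sf ltnS; apply/leq_sizeP => j; rewrite leq_eqVlt => /predU1P[<-|jf].
        by rewrite coefB coefZ coefXn eqxx mulr1 subrr.
      rewrite coefB coefZ coefXn gtn_eqF // mulr0 subr0.
      by apply: nth_default; rewrite sf.
    rewrite fE ED EM lf0 mul0r addr0 (IH g) // add0r.
    by rewrite E'X ?mul0r //; apply: fX.
  have [] := qmin (size f); first by exists f.
  case: hq => [[_ [[qX q0] [lq Eq]]]|->]; last by rewrite eqxx.
  move=> q_neq0 qf.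
  (* One step of pseudo-division: the leading terms cancel, and since [E'] kills [q.[x v]], its
     value at [g.[x v]] is a nonzero multiple of its value at [f.[x v]]. *)
  pose g := lead_coef q *: f - lead_coef f *: ('X^(size f - size q) * q).
  have gX i : gen X g`_i.
    rewrite coefB !coefZ; apply: gen_D.
      by apply: gen_M; [apply: qX|apply: fX].
    apply: gen_N; apply: gen_M; first exact: fX.
    by rewrite coefXnM; case: ifP => _; [apply: gen_0|apply: qX].
  have gE : g.[x v] = lead_coef q * f.[x v] -
      lead_coef f * (x v ^+ (size f - size q) * q.[x v]).
    by rewrite hornerD hornerN !hornerZ hornerM hornerXn.
  have g0 : phi g.[x v] = 0 by rewrite gE rmorphB !rmorphM f0 q0 !mulr0 subrr.
  have sg : (size g < k)%N.
    apply: (leq_trans _ (fk : (size f <= k)%N)).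
    have sf : size f = (size f).-1.+1 by rewrite prednK // size_poly_gt0.
    have sq : size q = (size q).-1.+1 by rewrite prednK // size_poly_gt0.
    have qf' : (size q - 1 <= size f - 1)%N by apply: leq_sub2r.
    rewrite sf ltnS; apply/leq_sizeP => j.
    rewrite coefB !coefZ coefXnM => fj.
    have -> : (j < size f - size q)%N = false.
      apply/negbTE; rewrite -leqNgt; apply: leq_trans fj.
      by rewrite sq -subn1 subnS subn1 -!subn1 -subnDA addnC subnDA leq_subr.
    move: fj; rewrite leq_eqVlt => /predU1P[<-|jf].
      have -> : ((size f).-1 - (size f - size q) = (size q).-1)%N.
        rewrite -subn1 -subnDA addnC subnDA subKn // subn1 //.
      by rewrite -!lead_coefE mulrC subrr.
    have {}jf : (size f <= j)%N by rewrite sf.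
    have -> : f`_j = 0 by apply: nth_default.
    have -> : q`_(j - (size f - size q)) = 0.
      apply: nth_default; rewrite leq_subRL; last exact: leq_trans (leq_subr _ _) jf.
      by rewrite subnK.
    by rewrite !mulr0 subrr.
  have := IH g sg (conj gX g0); rewrite gE ED der_alongN // !EM q0 Eq f0 rmorphM q0.
  rewrite !(mulr0, addr0, add0r, oppr0) => /eqP.
  by rewrite mulf_eq0 (negPf lq) => /eqP.
have kill (E' : R -> K) : (forall f, Xpoly f -> E' f.[x v] = 0) ->
    kills E' (fun w => X w \/ w = v).
  by move=> E'f p /gen_poly[f fX ->] f0; apply: E'f.
have [Qex|noQ] := EM (exists k, Q k); last first.
  exists E; split=> //; apply: kill; apply: (reduce E 0) => //; first by right.
  by move=> k Qk; case: noQ; exists k.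
have [k [q [[qX q0] lq sq]] kmin] := ex_min_nat Qex.
have q_neq0 : q != 0 by apply: contraNneq lq => ->; rewrite lead_coef0 rmorph0.
(* Separability: the leading coefficient of the derivative is a positive integer times that of [q],
   hence nonzero in [K]; if the derivative vanished at [x v], it would contradict the minimality of
   [q]. *)
have dq0 : phi q^`().[x v] != 0.
  apply/eqP => dq0; case sqE: (size q) => [|[|d]].
  - by move/eqP: sqE; rewrite size_poly_eq0 (negPf q_neq0).
  - move/eqP: sqE => /size_poly1P[c _ qE]; move: q0 lq.
    by rewrite qE hornerC lead_coefC => ->; rewrite eqxx.
  have cd : q^`()`_d = lead_coef q *+ d.+1 by rewrite coef_deriv lead_coefE sqE.
  have cd0 : phi (q^`()`_d) != 0.
    by rewrite cd rmorphMn -mulr_natr mulf_neq0.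
  have sd : size q^`() = d.+1.
    apply/eqP; rewrite eqn_leq -ltnS -sqE lt_size_deriv //= ltnNge.
    by apply: contra cd0 => /(nth_default 0)->; rewrite rmorph0.
  have: Q d.+1.
    exists q^`(); split=> //; last by rewrite lead_coefE sd.
    by split=> // i; rewrite coef_deriv; apply: gen_Mn.
  by move/kmin; rewrite -sq sqE ltnn.
(* The partial derivative in [x v]: adding a multiple of it does not change the values on X, and the
   multiplier [y] below makes the sum kill [q.[x v]]. *)
have [E1 E1d E1x] := der_exists (fun w => `[<w = v>]%:R).
have E1X w : X w -> E1 (x w) = 0.
  by move=> Xw; rewrite E1x; case: asboolP => // wv; rewrite wv in Xw.
have E1q (f : {poly R}) : (forall i, gen X f`_i) -> E1 f.[x v] = phi f^`().[x v].
  move=> fX; rewrite der_horner // => [|i]; last exact: der_gen0 E1X (fX i).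
  by rewrite E1x asboolT // mulr1.
pose y := - (E q.[x v] / phi q^`().[x v]).
pose E' p := E p + y * E1 p.
have Ed' : der_along E'.
  have [[ED EM' EC] [ED1 EM1 EC1]] := (Ed, E1d).
  split=> [a b|a b|c]; rewrite /E'.
  - by rewrite ED ED1; ring.
  - by rewrite EM' EM1; ring.
  - by rewrite EC EC1 mulr0 addr0.
have eqE w : X w -> E' (x w) = E (x w).
  by move=> /E1X; rewrite /E' => ->; rewrite mulr0 addr0.
exists E'; split=> //; apply: kill; apply: (reduce E' q) => //; first exact: agree.
  left; split; [by exists q | split=> //; split=> //].
  by rewrite /E' E1q // mulNr divfK // subrr.
by move=> l /kmin; rewrite sq.
Qed.

(** The variables outside B are adjoined one at a time in the order of their codes, V being
    countable; the value at a variable is final once its code has been passed. *)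
Lemma der_extend B E0 : (forall p, gen (fun=> True) p) ->
  der_along E0 -> kills E0 B ->
  exists E, [/\ der_along E, forall p, phi p = 0 -> E p = 0 &
    forall v, B v -> E (x v) = E0 (x v)].
Proof.
move=> genT E0d E0B.
pose X k v := B v \/ (choice.pickle v < k)%N.
pose ok k E := der_along E /\ kills E (X k).
have XS k v : X k v -> X k.+1 v by case=> [Bv|vk]; [left | right; apply: ltnW].
have step (kE : nat * (R -> K)) : exists E', ok kE.1 kE.2 ->
    ok kE.1.+1 E' /\ forall v, X kE.1 v -> E' (x v) = kE.2 (x v).
  case: kE => k E /=; have [[Ed EX]|nok] := EM (ok k E); last by exists E.
  have [[v [vk Xv]]|noV] := EM (exists v, choice.pickle v = k /\ ~ X k v).
    have [E' [E'd E'E E'X]] := der_extend1 Xv Ed EX.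
    exists E' => _; split=> //; split=> // p Xp; apply: E'X; apply: gen_sub Xp.
    move=> w [Bw|]; first by left; left.
    rewrite ltnS leq_eqVlt => /predU1P[wk|wk]; last by left; right.
    by right; apply: (pcan_inj choice.pickleK); rewrite wk vk.
  exists E => _; split=> //; split=> // p Xp; apply: EX; apply: gen_sub Xp.
  move=> w [Bw|]; first by left.
  rewrite ltnS leq_eqVlt => /predU1P[wk|wk]; last by right.
  by apply: contrapT => nX; case: noV; exists w.
have [next nextP] := choice step.
pose fix seqE k := if k is k'.+1 then next (k', seqE k') else E0.
have seq_ok k : ok k (seqE k).
  elim: k => [|k IH]; last by have [] := nextP (k, seqE k) IH.
  by split=> // p Xp; apply: E0B; apply: gen_sub Xp => w [].
have seqS k v : X k v -> seqE k.+1 (x v) = seqE k (x v).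
  by have [_] := nextP (k, seqE k) (seq_ok k); apply.
have seq_add k d v : X k v -> seqE (d + k)%N (x v) = seqE k (x v).
  move=> Xv; elim: d => // d IH; rewrite addSn seqS //.
  by elim: d {IH} => // d; apply: XS.
have [E Ed Ex] := der_exists (fun v => seqE (choice.pickle v).+1 (x v)).
have E_seq k v : X k v -> E (x v) = seqE k (x v).
  rewrite Ex => -[Bv|vk]; last by rewrite -(subnK vk) seq_add //; right.
  transitivity (seqE 0%N (x v)).
    by rewrite -[(choice.pickle v).+1]addn0 seq_add //; left.
  by rewrite -[k]addn0 seq_add //; left.
exists E; split=> // [p p0|v Bv]; last by rewrite (E_seq 0%N) //; left.
(* An element involves finitely many variables, so it is dealt with at a finite stage. *)
have [k Xp] : exists k, gen (X k) p.
  have mono k l q : gen (X k) q -> gen (X (l + k)%N) q.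
    by apply: gen_sub => v Xv; elim: l => // l; apply: XS.
  elim: (genT p) => [c|v _|a b _ [k Xa] _ [l Xb]|a b _ [k Xa] _ [l Xb]].
  - by exists 0%N; apply: gen_C.
  - by exists (choice.pickle v).+1; apply: gen_X; right.
  - by exists (l + k)%N; apply: gen_D; [apply: mono | rewrite addnC; apply: mono].
  - by exists (l + k)%N; apply: gen_M; [apply: mono | rewrite addnC; apply: mono].
rewrite (der_gen_eq Ed (seq_ok k).1 (X := X k)) // => [|v]; last exact: E_seq.
exact: (seq_ok k).2.
Qed.
End Ext.

(** * The matroid of differentials *)

Section Closure.
Context (F : Type) (V : Type) (R : comNzRingType) (K : fieldType).
Context (x : V -> R) (C : F -> R) (phi : {rmorphism R -> K}).
Implicit Types (B : V -> Prop) (v w : V).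

Definition tangent (E : R -> K) : Prop :=
  der_along C phi E /\ forall p, phi p = 0 -> E p = 0.

Definition cl B v : Prop :=
  forall E, tangent E -> (forall w, B w -> E (x w) = 0) -> E (x v) = 0.

Lemma cl_in B v : B v -> cl B v.
Proof. by move=> Bv E _; apply. Qed.

Lemma cl_trans B B' v : cl B v -> (forall w, B w -> cl B' w) -> cl B' v.
Proof. by move=> Bv BB' E Et E0; apply: Bv => // w /BB'; apply. Qed.

Lemma cl_sub B B' v : cl B v -> (forall w, B w -> B' w) -> cl B' v.
Proof. by move=> Bv BB'; apply: cl_trans Bv _ => w /BB'; apply: cl_in. Qed.

Lemma tangent_comb a b E E' : tangent E -> tangent E' ->
  tangent (fun p => a * E p + b * E' p).
Proof.
move=> [[ED EM EC] E0] [[ED' EM' EC'] E0']; split; first split=> [p q|p q|c].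
- by rewrite ED ED'; ring.
- by rewrite EM EM'; ring.
- by rewrite EC EC' !mulr0 addr0.
- by move=> p p0; rewrite E0 // E0' // !mulr0 addr0.
Qed.

(** Suppose [E] vanishes on B and at v but not at w. For any tangent [E'] vanishing on B, the
    combination E'(w) E - E(w) E' vanishes on B and at w, hence at v; so E'(v) = 0, which puts v in
    the closure of B. *)
Lemma cl_exchange B v w : cl (fun u => B u \/ u = w) v -> ~ cl B v ->
  cl (fun u => B u \/ u = v) w.
Proof.
move=> clv nclv E Et E0; apply: contrapT => /eqP Ew.
apply: nclv => E' Et' E0'; apply/eqP.
have Ev : E (x v) = 0 by apply: E0; right.
have: E' (x w) * E (x v) + - E (x w) * E' (x v) = 0.
  apply: (clv _ (tangent_comb (E' (x w)) (- E (x w)) Et Et')) => u [Bu|->].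
    have Eu : E (x u) = 0 by apply: E0; left.
    by rewrite /= Eu (E0' u Bu) !mulr0 addr0.
  by ring.
move/eqP; rewrite Ev mulr0 add0r mulf_eq0 oppr_eq0.
by rewrite (negPf Ew).
Qed.

Context (D : R -> R) (d : K -> K) (next : V -> V) (delta : F -> F).
Hypotheses (DD : forall p q, D (p + q) = D p + D q).
Hypotheses (DM : forall p q, D (p * q) = D p * q + p * D q).
Hypotheses (DC : forall c, D (C c) = C (delta c)).
Hypotheses (Dx : forall v, D (x v) = x (next v)).
Hypotheses (dD : forall y z, d (y + z) = d y + d z).
Hypotheses (dM : forall y z, d (y * z) = d y * z + y * d z).
Hypotheses (d_phi : forall p, d (phi p) = phi (D p)).

(* If E vanishes on B and on the derivatives of B, then the tangent vector
   [d, E] vanishes on B, hence at v, which gives E (x (next v)) = 0. *)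
Lemma cl_shift B v : cl B v ->
  cl (fun u => B u \/ exists2 w, B w & u = next w) (next v).
Proof.
move=> Bv E [[ED EM EC] E0] EB.
have d0 : d 0 = 0 by apply: (addrI (d 0)); rewrite -dD !addr0.
pose E' p := d (E p) - E (D p).
have Et' : tangent E'.
  split; first split=> [p q|p q|c]; rewrite /E'.
  - by rewrite ED DD ED dD; ring.
  - by rewrite EM DM ED !EM dD !dM !d_phi; ring.
  - by rewrite DC !EC d0 subr0.
  move=> p p0; rewrite E0 // d0 E0 ?subr0 //.
  by rewrite -d_phi p0.
have Ev : E (x v) = 0.
  by apply: Bv => // w Bw; apply: EB; left.
have := Bv E' Et'; rewrite /E' Ev d0 Dx sub0r => h.
apply/eqP; rewrite -oppr_eq0; apply/eqP; apply: h => w Bw.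
by rewrite Dx !EB ?d0 ?subr0 //; [right; exists w | left].
Qed.
End Closure.

Local Open Scope fset_scope.
Local Open Scope ring_scope.

(** * Derivations of differential polynomials *)

(* Locked versions of some concrete terms: unification otherwise unfolds the
   underlying finite maps. *)
HB.lock Definition mono (F : fieldType) (I : choiceType) (m : {cmonom I}) :
  {malg F[{cmonom I}]} := << m >>.
HB.lock Definition mdiv (I : choiceType) (m : {cmonom I}) (v : I) : {cmonom I} :=
  divcm m (ucm v).

(** [dmon] is the Leibniz rule on a monomial, and [der] is the derivation along [phi] given by [d0]
    on coefficients and by [lam] on variables. The derivation of the differential ring, the partial
    derivatives and the K-valued derivations are all instances. *)
HB.lock Definition dmon (F : fieldType) (I : choiceType) (S : comNzRingType)
    (phi : {malg F[{cmonom I}]} -> S) (lam : I -> S) (m : {cmonom I}) : S :=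
  \sum_(v <- finsupp m) (m v)%:R * phi (mono F (mdiv m v)) * lam v.
HB.lock Definition der (F : fieldType) (I : choiceType) (S : comNzRingType)
    (phi : {malg F[{cmonom I}]} -> S) (d0 : F -> S) (lam : I -> S)
    (p : {malg F[{cmonom I}]}) : S :=
  \sum_(m <- msupp p) (d0 p@_m * phi (mono F m) + phi (p@_m)%:MP * dmon phi lam m).

Section MalgTools.
Context (F : fieldType) (I : choiceType).
Implicit Types (p q : {malg F[{cmonom I}]}) (m : {cmonom (I)}) (v : I).

Lemma malg_add_ind (Q : {malg F[{cmonom I}]} -> Prop) p :
  Q 0 -> (forall q r, Q q -> Q r -> Q (q + r)) ->
  (forall c m, m \in msupp p -> Q << c *g m >>) -> Q p.
Proof.
move=> Q0 QD QU; rewrite (monalgE p) big_seq.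
by apply: big_ind => // m mp; apply: QU.
Qed.

Lemma malgU_mul (c c' : F) (m m' : {cmonom (I)}) :
  << c *g m >> * << c' *g m' >> = << c * c' *g mmul m m' >> :> {malg F[{cmonom I}]}.
Proof. by rewrite malgM_def fgmulUU. Qed.

Lemma mdivE m v w : mdiv m v w = (m w - (v == w))%N.
Proof. by rewrite mdiv.unlock divcmE cmU. Qed.

Lemma mdivK m v : (0 < m v)%N -> m = mmul (ucm v) (mdiv m v).
Proof.
move=> mv; apply/eqP/cmP=> w; rewrite cmM mdivE cmU.
case: eqP => [<-|_]; rewrite ?subn0 //. by rewrite subnKC.
Qed.

Lemma malgU_scale (c : F) m : << c *g m >> = c%:MP * mono F m.
Proof. by rewrite mono.unlock malgU_mul mulr1 mul1m. Qed.

Lemma monoM (m m' : {cmonom I}) : mono F (mmul m m') = mono F m * mono F m'.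
Proof. by rewrite mono.unlock malgU_mul mulr1. Qed.

Section Der.
Context (S : comNzRingType) (phi : {rmorphism {malg F[{cmonom I}]} -> S}).
Context (d0 : F -> S) (lam : I -> S).
Hypothesis d0D : forall x y, d0 (x + y) = d0 x + d0 y.
Hypothesis d0M : forall x y, d0 (x * y) = d0 x * phi y%:MP + phi x%:MP * d0 y.

Local Notation dmon := (dmon phi lam).
Local Notation der := (der phi d0 lam).

Lemma dmonEw m (d : {fset I}) : finsupp m `<=` d ->
  dmon m = \sum_(v <- d) (m v)%:R * phi (mono F (mdiv m v)) * lam v.
Proof.
move=> md; rewrite dmon.unlock (big_fset_incl _ md) // => v vd vm.
by move: vm; rewrite -cmE_eq0 => /eqP->; rewrite !mul0r.
Qed.

Lemma d0_0 : d0 0 = 0.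
Proof. by apply: (addrI (d0 0)); rewrite -d0D !addr0. Qed.

Lemma derEw p (d : {fset {cmonom (I)}}) : msupp p `<=` d ->
  der p = \sum_(m <- d) (d0 p@_m * phi (mono F m) + phi (p@_m)%:MP * dmon m).
Proof.
move=> pd; rewrite der.unlock (big_fset_incl _ pd) // => m md mp.
by rewrite (mcoeff_outdom mp) d0_0 malgC0E rmorph0 !mul0r addr0.
Qed.

Lemma derD p q : der (p + q) = der p + der q.
Proof.
rewrite (derEw (msuppD_le p q)) (derEw (fsubsetUl (msupp p) (msupp q))).
rewrite (derEw (fsubsetUr (msupp p) (msupp q))) -big_split /=.
apply: eq_bigr => m _; rewrite mcoeffD d0D raddfD rmorphD !mulrDl.
by rewrite addrACA.
Qed.

Lemma der0 : der 0 = 0.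
Proof. by rewrite der.unlock msupp0 big_seq_fset0. Qed.

Lemma derU c m : der << c *g m >> = d0 c * phi (mono F m) + phi c%:MP * dmon m.
Proof.
by rewrite (derEw msuppU_le) big_seq_fset1 mcoeffUU.
Qed.

Lemma dmonM (m1 m2 : {cmonom (I)}) :
  dmon (mmul m1 m2) = dmon m1 * phi (mono F m2) + phi (mono F m1) * dmon m2.
Proof.
(* The quotient by v is truncated and has no meaning when v does not divide m, but then the factor
   [m v] is zero. *)
have key (m m' : {cmonom I}) v :
    (m v)%:R * phi (mono F (mdiv (mmul m m') v)) =
    (m v)%:R * phi (mono F (mdiv m v)) * phi (mono F m').
  have [->|mv] := posnP (m v); first by rewrite !mul0r.
  rewrite -mulrA -rmorphM -monoM; congr (_ * phi (mono F _)).
  apply/eqP/cmP=> w; rewrite cmM !mdivE cmM.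
  by case: eqP => [<-|_]; rewrite ?subn0 // addnBAC.
rewrite (dmonEw (d := finsupp m1 `|` finsupp m2)) ?mdomD //.
rewrite (dmonEw (fsubsetUl (finsupp m1) (finsupp m2))).
rewrite (dmonEw (fsubsetUr (finsupp m1) (finsupp m2))).
rewrite mulr_suml mulr_sumr -big_split /=; apply: eq_bigr => v _.
have mC : mmul m1 m2 = mmul m2 m1 :> {cmonom I} by exact: mulcmC.
rewrite cmM natrD !mulrDl key mC key; ring.
Qed.

(** Both sides are additive in p and in q, which reduces the claim to two monomial terms and so to
    [dmonM]. *)
Lemma derM p q : der (p * q) = der p * phi q + phi p * der q.
Proof.
pose Q p q := der (p * q) = der p * phi q + phi p * der q.
have QC u w : Q u w -> Q w u.
  rewrite /Q (mulrC u w) => ->.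
  by move: (der u) (der w) (phi u) (phi w) => *; ring.
have Q0 w : Q 0 w by rewrite /Q mul0r der0 rmorph0 !mul0r addr0.
have QD w a b : Q a w -> Q b w -> Q (a + b) w.
  rewrite /Q => IHa IHb; rewrite mulrDl.
  transitivity (der (a * w) + der (b * w)); first exact: derD.
  rewrite [X in X + _]IHa [X in _ + X]IHb (derD a b) (rmorphD phi a b).
  by move: (der a) (der b) (phi a) (phi b) => *; ring.
rewrite -/(Q p q); apply: (malg_add_ind (Q := Q^~ q)) => // [a b|c m _].
  exact: QD.
apply: QC; apply: (malg_add_ind (Q := Q^~ _)) => // [a b|c' m' _].
  exact: QD.
have eM : Q << c' *g m' >> << c *g m >> =
    (der << c' * c *g mmul m' m >> =
     der << c' *g m' >> * phi << c *g m >> + phi << c' *g m' >> * der << c *g m >>).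
  by congr (_ = _); congr der; apply: malgU_mul.
rewrite eM {eM}.
have eC : phi (c' * c)%:MP = phi c'%:MP * phi c%:MP.
  transitivity (phi (c'%:MP * c%:MP)); last exact: rmorphM.
  by congr (phi _); apply: mpolyCM.
have eU (c0 : F) m0 : phi << c0 *g m0 >> = phi c0%:MP * phi (mono F m0).
  transitivity (phi (c0%:MP * mono F m0)); last exact: rmorphM.
  by congr (phi _); apply: malgU_scale.
rewrite [X in X = _](derU (c' * c)) [X in _ = X * _ + _](derU c').
rewrite [X in _ = _ * X + _](eU c m) [X in _ = _ + X * _](eU c' m').
rewrite [X in _ = _ + _ * X](derU c).
have -> : phi (mono F (mmul m' m)) = phi (mono F m') * phi (mono F m).
  by rewrite monoM rmorphM.
rewrite [X in X * _ + _ = _]d0M [X in _ + _ * X = _]dmonM [X in _ + X * _ = _]eC.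
have id (d' c0 c1 d m0 m1 e' e : S) :
    (d' * c0 + c1 * d) * (m1 * m0) + (c1 * c0) * (e' * m0 + m1 * e) =
    (d' * m1 + c1 * e') * (c0 * m0) + (c1 * m1) * (d * m0 + c0 * e) by ring.
exact: id.
Qed.

Lemma derC c : der c%:MP = d0 c.
Proof.
rewrite derU dmon.unlock mdom1 big_seq_fset0 mulr0 addr0 mono.unlock.
by rewrite rmorph1 mulr1.
Qed.

Lemma derX v : der << ucm v >> = lam v.
Proof.
have d1 : d0 1 = 0.
  have := d0M 1 1; rewrite mulr1 rmorph1 mulr1 mul1r => d1.
  by apply: (addrI (d0 1)); rewrite -d1 addr0.
rewrite derU d1 mul0r add0r rmorph1 mul1r dmon.unlock mdomU big_seq_fset1 cmUU.
have -> : mdiv (ucm v) v = mone.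
  by apply/eqP/cmP=> x; rewrite mdivE cmU cm1 subnn.
have -> : phi (mono F mone) = 1 by rewrite mono.unlock; apply: rmorph1.
by rewrite !mul1r.
Qed.
End Der.
End MalgTools.

HB.lock Definition dX (F : fieldType) (n : nat) (v : dvar n) : diffpoly F n :=
  << ucm v >>.
HB.lock Definition dC (F : fieldType) (n : nat) (c : F) : diffpoly F n := c%:MP.
(** Taken at the leader of a polynomial, this is the separant. *)
HB.lock Definition pder (F : fieldType) (n : nat) (v : dvar n) :
    diffpoly F n -> diffpoly F n :=
  der idfun (fun=> 0) (fun w : dvar n => (w == v)%:R : diffpoly F n).

(** * Partial derivatives: coefficients, variables and degrees *)

Section Deriv.
Context (F : fieldType) (n : nat).
Implicit Types (p q : diffpoly F n) (m : {cmonom (dvar n)}) (v : dvar n).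
Local Notation dX := (@dX F n).
Local Notation dC := (@dC F n).
Local Notation pder := (@pder F n).

Lemma dvarsP p v :
  reflect (exists2 m, m \in msupp p & v \in finsupp m) (v \in dvars p).
Proof.
rewrite /dvars; apply: (iffP idP) => [/bigfcupP[m]|[m mp vm]].
  by rewrite andbT => mp vm; exists m.
by apply/bigfcupP; exists m; rewrite ?mp.
Qed.

Lemma cmonom_ind (Q : {cmonom (dvar n)} -> Prop) :
  Q mone -> (forall v m, Q m -> Q (mmul (ucm v) m)) -> forall m, Q m.
Proof.
move=> Q1 QM m; have [d] := ubnP (mdeg m); elim: d m => // d IH m md.
have [->//|/eqP m1] := eqVneq m mone.
have [m0|[v vm]] := fset_0Vmem (finsupp m).
  by case: m1; apply/eqP/cmP=> v; apply/eqP; rewrite cm1 cmE_eq0 m0 inE.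
have mv : (0 < m v)%N by rewrite lt0n cmE_neq0.
rewrite (mdivK mv); apply: QM; apply: IH.
by move: md; rewrite {1}(mdivK mv) mdegM mdegU.
Qed.

Lemma diffpoly_ind (V : dvar n -> Prop) (Q : diffpoly F n -> Prop) :
  (forall c, Q (dC c)) -> (forall v, V v -> Q (dX v)) ->
  (forall p q, Q p -> Q q -> Q (p + q)) ->
  (forall p q, Q p -> Q q -> Q (p * q)) ->
  forall p, (forall v, v \in dvars p -> V v) -> Q p.
Proof.
move=> QC QX QD QM p pV; apply: malg_add_ind => //.
  by rewrite -malgC0E; have := QC 0; rewrite dC.unlock.
move=> c m mp; rewrite malgU_scale; apply: (QM).
  by have := QC c; rewrite dC.unlock.
have: forall v, v \in finsupp m -> V v.
  by move=> v vm; apply: pV; apply/dvarsP; exists m.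
elim/cmonom_ind: m {mp} => [|v m IH] mV.
  by have := QC 1; rewrite dC.unlock mono.unlock.
rewrite monoM; apply: (QM).
  have -> : mono F (ucm v) = dX v by rewrite mono.unlock dX.unlock.
  apply: QX; apply: mV.
  by rewrite mdomD mdomU !inE eqxx.
by apply: IH => w wm; apply: mV; rewrite mdomD !inE wm orbT.
Qed.

Lemma dvars_eq0 p : dvars p = fset0 -> exists c, p = dC c.
Proof.
move=> p0; exists p@_mone; rewrite dC.unlock.
apply/malgP => m; rewrite mcoeffC.
case: eqVneq => [->|m1]; first by rewrite mulr1n.
rewrite mulr0n; apply/eqP; rewrite mcoeff_eq0; apply/negP => mp.
case/eqP: m1; apply/eqP/cmP=> v; apply/eqP; rewrite cm1 cmE_eq0; apply/negP => vm.
have: v \in dvars p by apply/dvarsP; exists m.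
by rewrite p0.
Qed.

Lemma pderD v p q : pder v (p + q) = pder v p + pder v q.
Proof. by rewrite pder.unlock; apply: derD => *; rewrite addr0. Qed.

Lemma pderM v p q : pder v (p * q) = pder v p * q + p * pder v q.
Proof.
rewrite pder.unlock; apply: (@derM F _ (diffpoly F n) idfun (fun=> 0)) => *.
  by rewrite addr0.
by rewrite mul0r mulr0 addr0.
Qed.

Lemma pderU v c m :
  pder v << c *g m >> = << c *+ m v *g mdiv m v >>.
Proof.
rewrite pder.unlock (@derU F _ (diffpoly F n) idfun (fun=> 0)) => [|*];
  last by rewrite addr0.
rewrite mul0r add0r dmon.unlock.
have -> : \sum_(w <- finsupp m) (m w)%:R * idfun (mono F (mdiv m w)) *
    (w == v)%:R = (m v)%:R * mono F (mdiv m v).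
  have [vm|vm] := boolP (v \in finsupp m).
    rewrite (big_fsetD1 v) //= eqxx [X in X + _]mulr1 big_seq big1 ?addr0 // => w.
    by rewrite !inE => /andP[/negPf-> _]; rewrite [LHS]mulr0.
  move: (vm); rewrite -cmE_eq0 => /eqP->.
  rewrite [RHS]mul0r big_seq big1 // => w wm.
  by case: eqVneq => [wv|]; rewrite ?[LHS]mulr0 //; rewrite -wv wm in vm.
by rewrite malgU_scale [LHS]mulrA raddfMn -[X in _ = X * _]mulr_natr.
Qed.

(** The source of the bounds on the variables and degrees of a partial derivative and, in
    characteristic 0, of its non-vanishing. *)
Lemma mcoeff_pder v p m : (pder v p)@_m = p@_(mmul (ucm v) m) *+ (m v).+1.
Proof.
apply: (malg_add_ind
  (Q := fun p => (pder v p)@_m = p@_(mmul (ucm v) m) *+ (m v).+1)).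
- by rewrite pder.unlock der0 !mcoeff0 mul0rn.
- by move=> q r IHq IHr; rewrite pderD !mcoeffD IHq IHr mulrnDl.
move=> c m' _; rewrite pderU !mcoeffU.
have [e|ne] := eqVneq m' (mmul (ucm v) m).
  rewrite e cmM cmUU add1n; case: eqP => // -[].
  by apply/eqP/cmP=> w; rewrite mdivE cmM cmU addKn.
have [mv0|mv] := posnP (m' v); first by rewrite mv0 !(mulr0n, mul0rn).
rewrite [RHS]mul0rn; case: eqVneq => // e; case/eqP: ne.
by rewrite -e -mdivK.
Qed.

Lemma msupp_pder v p m : m \in msupp (pder v p) -> mmul (ucm v) m \in msupp p.
Proof.
rewrite -!mcoeff_neq0 mcoeff_pder; apply: contra => /eqP->.
by rewrite mul0rn.
Qed.

Lemma dvars_pder v p : dvars (pder v p) `<=` dvars p.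
Proof.
apply/fsubsetP=> w /dvarsP[m /msupp_pder mp wm]; apply/dvarsP.
by exists (mmul (ucm v) m) => //; rewrite mdomD !inE wm orbT.
Qed.

Lemma leq_degv v p m : m \in msupp p -> (m v <= degv v p)%N.
Proof. by move=> mp; rewrite /degv (big_fsetD1 m) //= leq_maxl. Qed.

Lemma degv_leP v p d :
  reflect (forall m, m \in msupp p -> m v <= d)%N (degv v p <= d)%N.
Proof.
rewrite /degv; apply: (iffP idP) => [pd m mp|pd].
  exact: leq_trans (leq_degv v mp) pd.
by rewrite big_seq; elim/big_ind: _ => // x y xd yd; rewrite geq_max xd.
Qed.

Lemma degv_gt0 v p : (0 < degv v p)%N = (v \in dvars p).
Proof.
rewrite lt0n -leqn0; apply/idP/idP; apply: contraTT.
  rewrite negbK => vp; apply/degv_leP => m mp; rewrite leqn0 cmE_eq0.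
  by apply: contra vp => vm; apply/dvarsP; exists m.
rewrite negbK => /degv_leP vp; apply/negP => /dvarsP[m /vp].
by rewrite leqn0 cmE_eq0 => /negP.
Qed.

Lemma degv_pder_le v w p : (degv w (pder v p) <= degv w p)%N.
Proof.
apply/degv_leP => m /msupp_pder /(leq_degv w); rewrite cmM.
by apply: leq_trans; rewrite leq_addl.
Qed.

Lemma degv_pder_lt v p : v \in dvars p -> (degv v (pder v p) < degv v p)%N.
Proof.
rewrite -degv_gt0 => p0; rewrite -[X in (_ < X)%N](prednK p0).
rewrite ltnS; apply/degv_leP => m /msupp_pder /(leq_degv v).
by rewrite cmM cmUU add1n; case: (degv v p) p0.
Qed.

Lemma pder_neq0 v p : [pchar F]%R =i pred0 -> v \in dvars p -> pder v p != 0.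
Proof.
move=> hc /dvarsP[m mp vm]; apply/eqP => /malgP/(_ (mdiv m v)).
have mv : (0 < m v)%N by rewrite lt0n cmE_neq0.
rewrite mcoeff_pder -mdivK // mcoeff0 -mulr_natr => /eqP.
rewrite mulf_eq0 mcoeff_eq0 mp /=.
by rewrite ((pcharf0P F).1 hc).
Qed.

Lemma msize_pder v p : v \in dvars p -> (msize (pder v p) < msize p)%N.
Proof.
move=> /dvarsP[m0 m0p _].
have p0 : (0 < msize p)%N by apply: leq_trans (msize_mdeg_lt m0p).
rewrite -[X in (_ < X)%N](prednK p0) ltnS msizeE.
rewrite big_seq; elim/big_ind: _ => // [x y xd yd|m /msupp_pder mp].
  by rewrite geq_max xd.
move/msize_mdeg_lt: mp; by rewrite mdegM mdegU add1n; case: (msize p).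
Qed.

Lemma pderC v c : pder v (dC c) = 0.
Proof.
by rewrite dC.unlock pderU; apply/eqP; rewrite monalgU_eq0 cm1.
Qed.

Lemma pderX v w : pder v (dX w) = (w == v)%:R.
Proof.
rewrite dX.unlock pderU cmU; case: eqVneq => [->|_]; last first.
  by rewrite mulr0n monalgU0.
have -> : mdiv (ucm v) v = mone; last by rewrite mulr1n.
by apply/eqP/cmP=> x; rewrite mdivE cmU cm1 subnn.
Qed.

Lemma dmonom_dmon m : dmonom F m = dmon idfun (fun v => dX (dnext v)) m.
Proof.
rewrite /dmonom dmon.unlock; apply: eq_bigr => v _.
have -> : mmul (divcm m (ucm v)) (ucm (dnext v)) =
  mmul (mdiv m v) (ucm (dnext v)) by rewrite mdiv.unlock.
rewrite malgU_scale monoM mulrA rmorph_nat; congr (_ * _).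
by rewrite dX.unlock mono.unlock.
Qed.

Lemma dpoly_der delta p :
  dpoly delta p = der idfun (fun c => dC (delta c)) (fun v => dX (dnext v)) p.
Proof.
rewrite /dpoly der.unlock; apply: eq_bigr => m _; congr (_ + _).
  by rewrite malgU_scale dC.unlock.
by rewrite dmonom_dmon -mul_malgC.
Qed.
End Deriv.

Lemma dXE (F : fieldType) n (v : dvar n) : dX F v = << ucm v >>.
Proof. by rewrite dX.unlock. Qed.

Lemma dCE (F : fieldType) n (c : F) : dC n c = c%:MP.
Proof. by rewrite dC.unlock. Qed.

Section Dvars.
Context (F : fieldType) (n : nat).
Implicit Types (p q : diffpoly F n) (v : dvar n).

Lemma dvarsC c : dvars (dC n c : diffpoly F n) = fset0.
Proof.
apply/fsetP=> v; rewrite inE; apply/negP => /dvarsP[m]; rewrite dCE.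
by move/(fsubsetP (msuppC_le c)); rewrite inE => /eqP->; rewrite mdom1.
Qed.

Lemma dvarsX v : dvars (dX F v) = [fset v].
Proof.
apply/fsetP=> w; rewrite inE dXE; apply/dvarsP/eqP => [[m]|->].
  move/(fsubsetP (@msuppU_le _ _ (ucm v) 1)); rewrite inE => /eqP->.
  by rewrite mdomU inE => /eqP.
exists (ucm v); last by rewrite mdomU inE.
by rewrite -mcoeff_neq0 mcoeffUU oner_neq0.
Qed.

Lemma dvarsD p q : dvars (p + q) `<=` dvars p `|` dvars q.
Proof.
apply/fsubsetP=> v /dvarsP[m /(fsubsetP (msuppD_le p q))].
by rewrite !inE => /orP[] mp vm; apply/orP; [left|right]; apply/dvarsP; exists m.
Qed.

Lemma dvarsM p q : dvars (p * q) `<=` dvars p `|` dvars q.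
Proof.
apply/fsubsetP=> v /dvarsP[m /msuppM_le[m1 [m2 [mp mq ->]]]].
rewrite mdomD !inE => /orP[] vm; apply/orP; [left|right]; apply/dvarsP.
  by exists m1.
by exists m2.
Qed.
End Dvars.

(** * The derivation of the differential polynomial ring *)

Section DPoly.
Context (F : fieldType) (n : nat) (delta : F -> F).
Hypothesis hdelta : derivation delta.
Implicit Types (p q : diffpoly F n) (v : dvar n).

Lemma dC_D (c c' : F) : dC n (c + c') = dC n c + dC n c'.
Proof. by rewrite dC.unlock raddfD. Qed.

Lemma dC_M (c c' : F) : dC n (c * c') = dC n c * dC n c'.
Proof. by rewrite dC.unlock rmorphM. Qed.

Lemma dC_1 : dC n (1 : F) = 1.
Proof. by rewrite dC.unlock. Qed.

Let dD : forall c c', dC n (delta (c + c')) = dC n (delta c) + dC n (delta c').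
Proof. by move=> c c'; rewrite hdelta.1 dC_D. Qed.

Let dDM : forall c c', dC n (delta (c * c')) =
  dC n (delta c) * idfun (c'%:MP : diffpoly F n) +
  idfun (c%:MP : diffpoly F n) * dC n (delta c').
Proof. by move=> c c'; rewrite hdelta.2 dC_D !dC_M /= dC.unlock. Qed.

Lemma dpolyD p q : dpoly delta (p + q) = dpoly delta p + dpoly delta q.
Proof. by rewrite !dpoly_der; apply: derD. Qed.

Lemma dpolyM p q : dpoly delta (p * q) = dpoly delta p * q + p * dpoly delta q.
Proof.
rewrite !dpoly_der.
apply: (@derM F _ (diffpoly F n) idfun (fun c => dC n (delta c))).
  exact: dD.
exact: dDM.
Qed.

Lemma dpolyX v : dpoly delta (dX F v) = dX F (dnext v).
Proof.
rewrite dpoly_der [dX F v]dXE.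
apply: (@derX F _ (diffpoly F n) idfun (fun c => dC n (delta c))); last exact: dDM.
exact: dD.
Qed.

Lemma dpolyC c : dpoly delta (dC n c) = dC n (delta c).
Proof.
rewrite dpoly_der [dC n c]dCE.
by apply: (@derC F _ (diffpoly F n) idfun (fun c => dC n (delta c))); apply: dD.
Qed.
End DPoly.

(** * Derivations of differential polynomials along a ring morphism *)

Section Along.
Context (F : fieldType) (n : nat) (S : comNzRingType).
Context (phi : {rmorphism diffpoly F n -> S}).
Implicit Types (p q : diffpoly F n) (v : dvar n).

Local Notation der_along := (@der_along F (diffpoly F n) S (dC n) phi).

Lemma der_along_exists (lam : dvar n -> S) :
  exists2 E, der_along E & forall v, E (dX F v) = lam v.
Proof.
have d0D (x y : F) : (0 : S) = 0 + 0 by rewrite addr0.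
have d0M (x y : F) : (0 : S) = 0 * phi y%:MP + phi x%:MP * 0.
  by rewrite mul0r mulr0 addr0.
exists (der phi (fun=> 0) lam).
  split=> [p q|p q|c]; [exact: derD | exact: derM |].
  by rewrite dC.unlock derC.
by move=> v; rewrite dX.unlock derX.
Qed.

(** The chain rule, E p = sum over w of phi (dp/dw) E(w), when only the term of v survives. *)
Lemma der_along_pder (E : diffpoly F n -> S) v p : der_along E ->
  (forall w, w \in dvars p -> w != v -> E (dX F w) = 0) ->
  E p = phi (pder v p) * E (dX F v).
Proof.
move=> [ED EM EC] E0.
pose V w := w != v -> E (dX F w) = 0.
apply: (diffpoly_ind (V := V)
  (Q := fun p => E p = phi (pder v p) * E (dX F v))) => //.
- by move=> c; rewrite EC pderC rmorph0 mul0r.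
- move=> w; rewrite /V pderX; case: eqVneq => [-> _|_ ->] //.
    by rewrite mulr1n rmorph1 mul1r.
  by rewrite mulr0n rmorph0 mul0r.
- move=> a b IHa IHb; rewrite ED pderD IHa IHb (rmorphD phi (pder v a)).
  by rewrite mulrDl.
- move=> a b IHa IHb; rewrite EM pderM IHa IHb.
  have -> : phi (pder v a * b + a * pder v b) =
      phi (pder v a) * phi b + phi a * phi (pder v b).
    transitivity (phi (pder v a * b) + phi (a * pder v b)); first exact: rmorphD.
    by congr (_ + _); apply: rmorphM.
  have id (x y z t e : S) : x * e * t + y * (z * e) = (x * t + y * z) * e by ring.
  exact: id.
Qed.
End Along.

(** * Bases of the form {x_j^(k), k < o_j} *)

Section Basis.
Context (F : fieldType) (n : nat) (P : diffpoly F n -> Prop).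
Hypothesis hchar : [pchar F]%R =i pred0.
Context (K : fieldType) (phi : {rmorphism diffpoly F n -> K}).
Hypothesis phiP : forall p, phi p = 0 <-> P p.
Implicit Types (p q : diffpoly F n) (v w : dvar n) (B : dvar n -> Prop).
Implicit Types (o : 'I_n -> nat).

Local Notation tangent := (tangent (dC n) phi).
Local Notation cl := (cl (@dX F n) (dC n) phi).

(** Algebraic independence of B modulo P; [free_extend] and [free_of_dual] relate it to linear
    independence of the differentials. *)
Definition free B : Prop :=
  forall p, P p -> (forall v, v \in dvars p -> B v) -> p = 0.

Definition box o : dvar n -> Prop := fun v => (v.2 < o v.1)%N.

Definition basis o : Prop := free (box o) /\ forall v, cl (box o) v.

Lemma prime_notin1 : ~ P 1.
Proof. by move=> /phiP; rewrite rmorph1 => /eqP; rewrite oner_eq0. Qed.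

Lemma prime_const c : P (dC n c) -> c = 0.
Proof.
move=> /phiP Pc; apply/eqP; case: (eqVneq c 0) => // c0; case: prime_notin1.
apply/phiP; rewrite -(dC_1 F n) -(mulVf c0) dC_M rmorphM Pc.
exact: mulr0.
Qed.

Lemma dC_0 : dC n (0 : F) = 0.
Proof. by rewrite dCE malgC0E. Qed.

Lemma phi_char k : (k.+1)%:R != 0 :> K.
Proof.
apply/eqP => k0.
have e : dC n (k.+1%:R : F) = k.+1%:R.
  elim: k {k0} => [|k IH]; first by rewrite mulr1n dC_1 mulr1n.
  by rewrite -addn1 !natrD dC_D IH mulr1n dC_1 mulr1n.
have: P (dC n (k.+1%:R : F)) by apply/phiP; rewrite e rmorph_nat.
by move/prime_const/eqP; rewrite ((pcharf0P F).1 hchar).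
Qed.

Lemma gen_dvars B p : gen (@dX F n) (dC n) B p -> forall v, v \in dvars p -> B v.
Proof.
elim=> [c v|w Bw v|a b _ IHa _ IHb v|a b _ IHa _ IHb v].
- by rewrite dvarsC.
- by rewrite dvarsX inE => /eqP->.
- by move/(fsubsetP (dvarsD a b)); rewrite inE => /orP[/IHa|/IHb].
- by move/(fsubsetP (dvarsM a b)); rewrite inE => /orP[/IHa|/IHb].
Qed.

(** A polynomial in the variables of B that lies in P is zero, so no relation obstructs the choice
    of values on B, and [der_extend] applies. *)
Lemma free_extend B (lam : dvar n -> K) : free B ->
  exists2 E, tangent E & forall v, B v -> E (dX F v) = lam v.
Proof.
move=> fB; have [E0 E0d E0x] := der_along_exists phi lam.
have genT p : gen (@dX F n) (dC n) (fun=> True) p.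
  apply: (diffpoly_ind (V := fun=> True)) => // *;
    [exact: gen_C|exact: gen_X|exact: gen_D|exact: gen_M].
have kill : kills (@dX F n) (dC n) phi E0 B.
  move=> p Bp /phiP Pp; rewrite (fB p Pp (gen_dvars Bp)).
  exact: (der_along0 E0d).
have [E [Ed EP EB]] := der_extend (@dC_D F n) (dC_1 F n) phi_char
  (der_along_exists phi) genT E0d kill.
by exists E => // v Bv; rewrite EB.
Qed.

Lemma tangent_sum (T : finType) (E : T -> diffpoly F n -> K) (u : T -> K) :
  (forall t, tangent (E t)) -> tangent (fun p => \sum_t u t * E t p).
Proof.
move=> Et; split; first split=> [p q|p q|c].
- rewrite -big_split; apply: eq_bigr => t _.
  by case: (Et t) => -[-> _ _ _]; rewrite mulrDr.
- rewrite mulr_suml mulr_sumr -big_split; apply: eq_bigr => t _.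
  case: (Et t) => -[_ -> _ _] /=; rewrite mulrDr mulrA; congr (_ + _).
  exact: mulrCA.
- by rewrite big1 // => t _; case: (Et t) => -[_ _ -> _]; rewrite mulr0.
- by move=> p p0; rewrite big1 // => t _; case: (Et t) => _ ->; rewrite ?mulr0.
Qed.

(** Take a relation p and a variable v of p. A tangent vector supported at v within B turns E p = 0
    into a relation for the partial derivative in v; its total degree is smaller, so it is zero by
    induction, which is absurd in characteristic 0. *)
Lemma free_of_dual B :
  (forall v, B v -> exists E, [/\ tangent E, E (dX F v) != 0 &
     forall w, B w -> w != v -> E (dX F w) = 0]) -> free B.
Proof.
move=> dual p; have [k] := ubnP (msize p); elim: k p => // k IH p pk Pp pB.
have [p0|[v vp]] := fset_0Vmem (dvars p).
  have [c pE] := dvars_eq0 p0; move: Pp; rewrite pE => /prime_const ->.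
  exact: dC_0.
have [E [[Ed EP] Ev Ew]] := dual v (pB v vp).
have: E p = 0 by apply: EP; apply/phiP.
rewrite (der_along_pder (v := v) Ed) => [|w wp]; last by apply: Ew; apply: pB.
move/eqP; rewrite mulf_eq0 (negPf Ev) orbF => /eqP/phiP Pd.
have: pder v p = 0.
  apply: IH => //; first exact: leq_trans (msize_pder vp) (pk : (msize p <= k)%N).
  by move=> w /(fsubsetP (dvars_pder v p)); apply: pB.
by move/eqP; rewrite (negPf (pder_neq0 hchar vp)).
Qed.

(** A spanning box with as many elements as a basis is a basis: the dual system of the basis is
    converted into one for the new box by inverting a square matrix. *)
Lemma basis_card o o' : basis o -> (forall v, cl (box o') v) ->
  (\sum_j o j = \sum_j o' j)%N -> basis o'.
Proof.
move=> [fo clo] clo' eo; split=> //.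
pose T (a : 'I_n -> nat) : finType := {j : 'I_n & 'I_(a j)}.
pose tv a (t : T a) : dvar n := (tag t, nat_of_ord (tagged t)).
have cardT a : #|T a| = (\sum_j a j)%N.
  rewrite card_tagged sumnE big_map big_enum /=.
  by apply: eq_bigr => j _; rewrite card_ord.
have tvB a (t : T a) : box a (tv a t) by rewrite /box /=.
have Btv a v : box a v -> exists t : T a, v = tv a t.
  case: v => j k /= kj; exists (Tagged (fun j => 'I_(a j)) (Ordinal kj)).
  by [].
have tv_inj a : injective (tv a).
  move=> [j k] [j' k'] [/= jj']; case: _ / jj' k' => k' kk'.
  by congr (Tagged _ _); apply: val_inj.
have /choice[E EP] : forall t : T o, exists E, tangent E /\
    forall s : T o, E (dX F (tv o s)) = (s == t)%:R.
  move=> t; have [E Et Ex] := free_extend (fun v => (v == tv o t)%:R) fo.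
  by exists E; split=> // s; rewrite Ex // (inj_eq (tv_inj o)).
pose M := \matrix_(i < #|T o|, k < #|T o'|)
  E (enum_val i) (dX F (tv o' (enum_val k))).
(* A combination of the dual vectors that vanishes on the box of [o'] vanishes everywhere, since
   that box spans; evaluation on the box of [o] then recovers the coefficients. *)
have Mfree : row_free M.
  rewrite -kermx_eq0; apply/rowV0P => u /sub_kermxP uM.
  pose Eu p := \sum_i u 0 i * E (enum_val i) p.
  have Eut : tangent Eu by apply: tangent_sum => i; case: (EP (enum_val i)).
  have Eu0 v : Eu (dX F v) = 0.
    apply: clo' => // _ /Btv[t ->].
    have /rowP/(_ (enum_rank t)) := uM; rewrite !mxE => <-.
    by apply: eq_bigr => i _; rewrite mxE enum_rankK.
  apply/rowP => i; rewrite mxE -(Eu0 (tv o (enum_val i))) /Eu (bigD1 i) //=.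
  rewrite (EP (enum_val i)).2 eqxx mulr1 big1 ?addr0 // => k ki.
  by rewrite (EP (enum_val k)).2 (inj_eq enum_val_inj) eq_sym (negPf ki) mulr0.
have Mfull : row_full M.
  by rewrite /row_full (eqP Mfree) !cardT eo.
have [N NM] := row_fullP Mfull.
apply: free_of_dual => v /Btv[t ->].
(* The rows of the left inverse [N] of [M] give the system dual to the box of [o']. *)
pose Et p := \sum_i N (enum_rank t) i * E (enum_val i) p.
have EtE s : Et (dX F (tv o' s)) = (t == s)%:R.
  have /matrixP/(_ (enum_rank t) (enum_rank s)) := NM.
  rewrite !mxE (inj_eq enum_rank_inj) => <-.
  by apply: eq_bigr => i _; rewrite mxE enum_rankK.
exists Et; split=> [||w /Btv[s ->] st].
- by apply: tangent_sum => i; case: (EP (enum_val i)).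
- by rewrite EtE eqxx mulr1n oner_neq0.
- by rewrite EtE; case: (eqVneq t s) => // ts; move: st; rewrite ts eqxx.
Qed.
End Basis.

(** * Characteristic sets *)

Section Autoreduced.
Context (F : fieldType) (n : nat) (r : rel (dvar n)).
Hypothesis hr : ranking r.
Implicit Types (p q : diffpoly F n) (u v w : dvar n) (s t : seq (diffpoly F n)).

Lemma ranking_refl v : r v v.
Proof. by case: hr => rt _ _ _ _; have := rt v v; rewrite orbb. Qed.

Lemma ranking_le (j : 'I_n) k l : r (j, k) (j, l) -> (k <= l)%N.
Proof.
have [rt ra rtr rn _] := hr.
have up d m : r (j, m) (j, (d + m)%N).
  elim: d => [|d IH]; first exact: ranking_refl.
  by apply: rtr IH _; rewrite addSn; apply: (rn (j, (d + m)%N)).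
move=> kl; rewrite leqNgt; apply/negP => lk.
have lk' : r (j, l) (j, k) by rewrite -(subnK (ltnW lk)); apply: up.
have [e] : (j, k) = (j, l) by apply: ra; rewrite kl.
by rewrite e ltnn in lk.
Qed.

Lemma leader_in p v : leader r p v -> v \in dvars p.
Proof. by case/andP. Qed.

Lemma leader_max p v w : leader r p v -> w \in dvars p -> r w v.
Proof. by case/andP=> _ /allP; apply. Qed.

Lemma leader_uniq p u v : leader r p u -> leader r p v -> u = v.
Proof.
move=> pu pv; have [_ ra _ _ _] := hr; apply: ra.
by rewrite (leader_max pv (leader_in pu)) (leader_max pu (leader_in pv)).
Qed.

Lemma leader_exists p v : v \in dvars p -> exists u, leader r p u.
Proof.
have [rt _ rtr _ _] := hr.
have mx (s : seq (dvar n)) w : w \in s -> exists2 u, u \in s & all (r^~ u) s.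
  elim: s w => // a s IH _ _.
  case: s IH => [_|b s IH].
    by exists a; rewrite ?inE //= ranking_refl.
  have [u us um] := IH b (mem_head _ _).
  case/orP: (rt a u) => au.
    by exists u; [rewrite inE us orbT | rewrite /= au].
  exists a; first exact: mem_head.
  apply/allP => x; rewrite inE => /predU1P[->|xs]; first exact: ranking_refl.
  apply: (rtr u) => //.
  exact: (allP um x xs).
by move=> vp; have [u up um] := mx _ _ vp; exists u; apply/andP.
Qed.

Lemma leader_ordx p j k : leader r p (j, k) -> ordx j p = k.
Proof.
move=> pk; apply/eqP; rewrite eqn_leq /ordx; apply/andP; split.
  rewrite big_seq_cond.
  elim/big_ind: _ => // [x y xk yk|[j' l] /= /andP[lp /eqP jj']].
    by rewrite geq_max xk.
  by apply: (@ranking_le j); rewrite -{1}jj'; apply: leader_max pk lp.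
by apply: (@leq_bigmax_seq _ _ (fun v => v.1 == j) (fun v => v.2) (j, k));
  rewrite ?(leader_in pk) ?eqxx.
Qed.

Lemma notin_reduced p q j k : leader r q (j, k) ->
  (forall l, (k <= l)%N -> (j, l) \notin dvars p) ->
  (forall l, (k < l)%N -> (j, l) \notin dvars p) /\
  (degv (j, k) p < degv (j, k) q)%N.
Proof.
move=> qjk nin; split=> [l /ltnW|]; first exact: nin.
have /eqP-> : degv (j, k) p == 0%N by rewrite -leqn0 leqNgt degv_gt0 nin.
by rewrite degv_gt0 (leader_in qjk).
Qed.

(** Because of this, in a list with increasing leaders only the later elements have to be checked
    against the earlier ones. *)
Lemma reduced_lower p q u v : leader r p u -> leader r q v -> u != v -> r u v ->
  reduced r p q.
Proof.
have [_ ra rtr _ _] := hr => pu qv uv ruv j k /(leader_uniq qv) vE; subst v.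
have nin l : (k <= l)%N -> (j, l) \notin dvars p.
  move=> kl; apply: contra uv => /(leader_max pu) lu; apply/eqP/ra; rewrite ruv.
  have lk := rtr _ _ _ lu ruv.
  by have -> : k = l by apply/eqP; rewrite eqn_leq kl (ranking_le lk).
exact: notin_reduced.
Qed.

Lemma autoreduced_cat s t : autoreduced r (s ++ t) -> autoreduced r s.
Proof.
move=> [sl sr so]; split=> [p ps|p q ps qs|i j /andP[ij js]].
- by apply: sl; rewrite mem_cat ps.
- by apply: sr; rewrite mem_cat ?ps ?qs.
- have := so i j; rewrite !nth_cat js (ltn_trans ij js) ij size_cat.
  by apply; rewrite (leq_trans js) ?leq_addr.
Qed.

Lemma autoreduced_rcons s p v : autoreduced r s -> leader r p v ->
  (forall q, q \in s -> reduced r p q) ->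
  (forall q u, q \in s -> leader r q u -> u != v /\ r u v) ->
  autoreduced r (rcons s p).
Proof.
move=> [sl sr so] pv pred plow; split=> [q|q q'|i j].
- by rewrite mem_rcons inE => /predU1P[->|/sl//]; exists v.
- rewrite !mem_rcons !inE => /predU1P[->|qs] /predU1P[->|q's] qq'.
  + by rewrite eqxx in qq'.
  + exact: pred.
  + have [u qu] := sl q qs; have [uv ruv] := plow q u qs qu.
    exact: reduced_lower pv uv ruv.
  + exact: sr.
- rewrite size_rcons ltnS !nth_rcons => /andP[ij].
  rewrite leq_eqVlt => /predU1P[jE|js].
    rewrite jE ltnn eqxx -jE ij.
    have si : s`_i \in s by rewrite mem_nth // -jE.
    have [u qu] := sl _ si; have [uv ruv] := plow _ _ si qu.
    by exists u, v.
  by rewrite js (ltn_trans ij js); apply: so; rewrite ij.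
Qed.

Lemma lower_set_cat s t t' : (forall q, q \in s -> exists u, leader r q u) ->
  lower_set r t t' -> lower_set r (s ++ t) (s ++ t').
Proof.
elim: s => // q s IH sl tt'; right; split.
  by have [u qu] := sl q (mem_head _ _); exists u.
by apply: IH => // p ps; apply: sl; rewrite inE ps orbT.
Qed.
End Autoreduced.

Lemma split_at_first (T : Type) (a : pred T) (s : seq T) :
  exists s1 s2, [/\ s = s1 ++ s2, all (predC a) s1 &
    s2 = [::] \/ exists q s3, s2 = q :: s3 /\ a q].
Proof.
elim: s => [|x s [s1 [s2 [-> s1a s2a]]]].
  by exists [::], [::]; split=> //; left.
case ax: (a x); last by exists (x :: s1), s2; split=> //=; rewrite ax.
by exists [::], (x :: s1 ++ s2); split=> //; right; exists x, (s1 ++ s2).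
Qed.

(** * Characteristic sets of a prime ideal: reduced elements and separants *)

Section CharSet.
Context (F : fieldType) (n : nat) (P : diffpoly F n -> Prop).
Hypothesis hchar : [pchar F]%R =i pred0.
Context (K : fieldType) (phi : {rmorphism diffpoly F n -> K}).
Hypothesis phiP : forall p, phi p = 0 <-> P p.
Implicit Types (p q : diffpoly F n) (u v w : dvar n) (s t : seq (diffpoly F n)).
Implicit Types (o : 'I_n -> nat).

Local Notation tangent := (tangent (dC n) phi).
Local Notation cl := (cl (@dX F n) (dC n) phi).
Local Notation basis := (basis P phi).

Lemma prime_dvars p : P p -> p != 0 -> exists v, v \in dvars p.
Proof.
move=> Pp p0; have [d0|[v vp]] := fset_0Vmem (dvars p); last by exists v.
have [c pE] := dvars_eq0 d0; move: Pp p0; rewrite pE => /(prime_const phiP)->.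
by rewrite dC_0 eqxx.
Qed.

Section Ranking.
Context (r : rel (dvar n)).
Hypothesis hr : ranking r.

(** A nonzero p, put after the elements of [s] with lower leader and in place of all the others,
    would give an autoreduced set in P lower than [s]. *)
Lemma char_set_reduced s p : char_set r P s -> P p ->
  (forall q, q \in s -> reduced r p q) -> p = 0.
Proof.
move=> [sa sP smin] Pp pred; apply/eqP; apply: contrapT => /negP p0.
have [w wp] := prime_dvars Pp p0; have [v pv] := leader_exists hr wp.
have [rt ra rtr _ _] := hr.
pose a q := has (fun u => leader r q u && r v u) (dvars q).
have [s1 [s2 [sE s1a s2a]]] := split_at_first a s.
have sl : forall q, q \in s -> exists u, leader r q u by case: sa.
have s1l q : q \in s1 -> q \in s by rewrite sE mem_cat => ->.
have low q u : q \in s1 -> leader r q u -> u != v /\ r u v.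
  move=> qs qu; have := allP s1a q qs; rewrite /= => /hasPn/(_ u (leader_in qu)).
  rewrite qu /= => nvu; split.
    by apply: contraNneq nvu => ->; apply: ranking_refl.
  by case/orP: (rt u v) => // vu; rewrite vu in nvu.
apply: (smin (rcons s1 p)).
- apply: (autoreduced_rcons hr (v := v)) => //.
    by apply: (@autoreduced_cat _ _ _ s1 s2); rewrite -sE.
  by move=> q /s1l; apply: pred.
- by move=> q; rewrite mem_rcons inE => /predU1P[->//|/s1l/sP].
rewrite sE -cats1; apply: lower_set_cat; first by move=> q /s1l/sl.
case: s2a => [->//|[q [s3 [s2E /hasP[u _ /andP[qu vu]]]]]].
rewrite s2E /=; left.
(* When p and the first replaced element have the same leader, reducedness of p makes its degree in
   it smaller. *)
have [uv|uv] := eqVneq v u; last by left; exists v, u.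
right; exists v; rewrite {2}uv; split=> //.
have qs : q \in s by rewrite sE s2E mem_cat mem_head orbT.
case: v uv {pv vu low a s1a} => j k uv.
have qjk : leader r q (j, k) by rewrite uv.
by have [_] := pred q qs j k qjk.
Qed.

Variables (s : seq (diffpoly F n)) (A : 'I_n -> diffpoly F n) (o : 'I_n -> nat).
Hypotheses (cs : char_set r P s) (sA : perm_eq s (codom A)).
Hypothesis Al : forall j, leader r (A j) (j, o j).

Let memA q : q \in s -> exists j, q = A j.
Proof. by rewrite (perm_mem sA) => /codomP. Qed.

Let A_mem j : A j \in s.
Proof. by rewrite (perm_mem sA) codom_f. Qed.

Let A_P j : P (A j).
Proof. by case: cs => _ + _; apply. Qed.

Lemma char_set_free : free P (box o).
Proof.
move=> p Pp pB; apply: (char_set_reduced cs Pp) => q /memA[j ->] i k.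
move=> /(leader_uniq hr (Al j))[<- <-].
have nin l : (o j <= l)%N -> (j, l) \notin dvars p.
  by move=> ol; apply/negP => /pB; rewrite /box /= ltnNge ol.
exact: notin_reduced (Al j) nin.
Qed.

(** The separant of [A j] is nonzero and inherits reducedness: its degree in the leader of [A j]
    drops, and elsewhere [A j] is already reduced. *)
Lemma separant_notin j : ~ P (pder (j, o j) (A j)).
Proof.
move=> PS; have Aj := leader_in (Al j).
suff /eqP : pder (j, o j) (A j) = 0 by rewrite (negPf (pder_neq0 hchar Aj)).
apply: (char_set_reduced cs PS) => q qs i k qk.
have [qA|qA] := eqVneq q (A j).
  move: qk; rewrite qA => /(leader_uniq hr (Al j))[<- <-].
  split=> [l ol|]; last exact: degv_pder_lt.
  apply/negP => /(fsubsetP (dvars_pder _ _))/(leader_max (Al j))/(ranking_le hr).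
  by rewrite leqNgt ol.
have [[_ sr _] _ _] := cs; rewrite eq_sym in qA.
have [nd dg] := sr _ _ (A_mem j) qs qA i k qk.
split=> [l kl|]; last exact: leq_ltn_trans (degv_pder_le _ _ _) dg.
by apply: contra (nd l kl) => /(fsubsetP (dvars_pder _ _)).
Qed.

(** A tangent vector kills [A j], so by the chain rule it kills the leader once it kills the other
    variables of [A j]. Each of those is in the box or, by reducedness, is the leader of an [A l]
    that comes earlier in [s]; hence an induction on the position. *)
Lemma char_set_leaders_cl j : cl (box o) (j, o j).
Proof.
have [[sl sr so] _ _] := cs; have [rt ra rtr _ _] := hr.
have : exists2 i, (i < size s)%N & s`_i = A j.
  by exists (index (A j) s); rewrite ?index_mem ?nth_index.
case=> i; elim/ltn_ind: i j => i IH j si sE E Et EB.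
have [Ed EP] := Et.
have: E (A j) = 0 by apply: EP; apply/phiP/A_P.
rewrite (der_along_pder (v := (j, o j)) Ed) => [/eqP|].
  rewrite mulf_eq0 => /orP[/eqP/phiP PS|/eqP//].
  by case: (separant_notin PS).
move=> [l k] lk ne; have [kl|kl] := ltnP k (o l); first exact: EB.
have lkj := leader_max (Al j) lk.
have [lj|lj] := eqVneq l j.
  case/eqP: ne; subst l; congr (_, _); apply/eqP.
  by rewrite eqn_leq kl andbT (ranking_le hr lkj).
have Alj : A j != A l.
  apply: contra lj => /eqP e; have := Al j.
  by rewrite e => /(leader_uniq hr (Al l))[->].
have [nd _] := sr _ _ (A_mem j) (A_mem l) Alj _ _ (Al l).
have kE : k = o l.
  apply/eqP; rewrite eqn_leq kl andbT leqNgt; apply/negP => /nd.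
  by rewrite lk.
subst k; have [i' si' s'E] : exists2 i', (i' < size s)%N & s`_i' = A l.
  by exists (index (A l) s); rewrite ?index_mem ?nth_index.
apply: (IH i') => //.
rewrite ltnNge leq_eqVlt; apply/negP => /orP[/eqP ii'|ii'].
  by case/eqP: Alj; rewrite -sE -s'E ii'.
have ltii : (i < i' < size s)%N by rewrite ii'.
have [u [v []]] := so i i' ltii.
rewrite sE s'E => /(leader_uniq hr (Al j))<- /(leader_uniq hr (Al l))<- ne' jl.
by case/eqP: ne'; apply: ra; rewrite jl lkj.
Qed.
End Ranking.
End CharSet.

(** * Finiteness and comparison of autoreduced sets *)

Section AutoreducedSize.
Context (F : fieldType) (n : nat) (r : rel (dvar n)).
Hypothesis hr : ranking r.
Implicit Types (p q : diffpoly F n) (s t : seq (diffpoly F n)).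

Lemma autoreduced_neq s i j : autoreduced r s ->
  (i < size s)%N -> (j < size s)%N -> i != j -> s`_i != s`_j.
Proof.
move=> [_ _ so]; wlog ij : i j / (i < j)%N => [wl si sj ij|_ js _].
  case: (ltngtP i j) => // lt; first exact: wl.
    by rewrite eq_sym; apply: wl => //; rewrite eq_sym.
  by rewrite lt eqxx in ij.
have ijs : (i < j < size s)%N by rewrite ij.
have [u [v [pu qv uv _]]] := so i j ijs.
by apply: contra uv => /eqP e; move: pu; rewrite e => /(leader_uniq hr qv)->.
Qed.

Lemma autoreduced_uniq s : autoreduced r s -> uniq s.
Proof.
move=> sa; apply/(uniqP 0) => i j si sj e; apply/eqP; apply: contraT => ij.
by move: (autoreduced_neq sa si sj ij); rewrite e eqxx.
Qed.

Lemma autoreduced_leader_inj s p q j k l : autoreduced r s ->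
  p \in s -> q \in s -> leader r p (j, k) -> leader r q (j, l) -> p = q.
Proof.
move=> [_ sr _] ps qs pk ql; apply/eqP; apply: contraT => pq.
have qp : q != p by rewrite eq_sym.
have [ndp dp] := sr p q ps qs pq j l ql; have [ndq dq] := sr q p qs ps qp j k pk.
have [kl|lk|e] := ltngtP k l.
- by move: (ndq l kl); rewrite (leader_in ql).
- by move: (ndp k lk); rewrite (leader_in pk).
- by subst l; have := ltn_trans dp dq; rewrite ltnn.
Qed.

Lemma autoreduced_size s : autoreduced r s -> (size s <= n.+1)%N.
Proof.
move=> sa; have [sl _ _] := sa.
(* Elements of [s] are told apart by the variable of their leader. The default [None] is never taken
   on [s] but is counted, whence the bound [n.+1]. *)
pose g q : option 'I_n :=
  [pick j | has (fun v => (v.1 == j) && leader r q v) (dvars q)].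
have gP q : q \in s -> exists j k, g q = Some j /\ leader r q (j, k).
  move=> /sl[[j k] qjk]; rewrite /g; case: pickP => [i|].
    move=> /hasP[[i' l] _ /= /andP[/eqP-> ql]].
    by exists i, l.
  by move/(_ j)/negP; case; apply/hasP; exists (j, k); rewrite ?(leader_in qjk) ?eqxx.
have ug : uniq (map g s).
  rewrite map_inj_in_uniq ?autoreduced_uniq // => p q ps qs gpq.
  have [j [k [gp pk]]] := gP p ps; have [j' [l [gq ql]]] := gP q qs.
  have e : j = j' by move: gpq; rewrite gp gq => -[].
  by subst j'; apply: autoreduced_leader_inj ps qs pk ql.
rewrite -(size_map g) -(card_uniqP ug) (leq_trans (max_card _)) //.
by rewrite card_option card_ord.
Qed.

Lemma reduced_same_rank p q q' :
  same_rank r q q' -> reduced r p q -> reduced r p q'.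
Proof.
move=> [u [qu q'u e]] pq j k q'jk; have uE := leader_uniq hr q'u q'jk; subst u.
by have [? ?] := pq j k qu; rewrite -e.
Qed.

Lemma lower_set_first t s : lower_set r t s -> exists i,
  [/\ (i < size t)%N, (i <= size s)%N,
      forall k, (k < i)%N -> same_rank r t`_k s`_k &
      (i < size s)%N -> lower_rank r t`_i s`_i].
Proof.
elim: t s => [|p t IH] [|q s] //=; first by exists 0%N.
case=> [pq|[pq /IH[i [it si sm lo]]]]; first by exists 0%N.
by exists i.+1; split=> // -[|k] //= ki; apply: sm.
Qed.
End AutoreducedSize.

(** * Existence of characteristic sets *)

Section CharSetExists.
Context (F : fieldType) (n : nat) (P : diffpoly F n -> Prop).
Context (f : dvar n -> nat).
(** The ranking is read off a numerical function, so that minimal ranks come from the well-ordering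
    of the natural numbers. *)
Let r : rel (dvar n) := fun u v => (f u <= f v)%N.
Hypothesis hr : ranking r.
Implicit Types (p q : diffpoly F n) (u v w : dvar n) (s t : seq (diffpoly F n)).

Lemma min_rank (Q : diffpoly F n -> Prop) : (exists p, Q p) ->
  (forall p, Q p -> exists v, leader r p v) ->
  exists2 p, Q p & forall q, Q q -> ~ lower_rank r q p.
Proof.
have [_ ra _ _ _] := hr; move=> [p0 Qp0] Ql; have [v0 p0v] := Ql p0 Qp0.
have [|k [p1 [v1 [Qp1 p1v vk]]] kmin] :=
    ex_min_nat (Q := fun k => exists p v, [/\ Q p, leader r p v & f v = k]).
  by exists (f v0), p0, v0.
have [|e [p [v [Qp pv fv dv]]] emin] :=
    ex_min_nat (Q := fun e => exists p v,
      [/\ Q p, leader r p v, f v = k & degv v p = e]).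
  by exists (degv v1 p1), p1, v1.
exists p => // q Qq [[u [v' [qu pv' uv]]]|[u [qu pu lt]]].
  move: pv' uv => /(leader_uniq hr pv)<- uv; rewrite /r fv => fu.
  have ku : (k <= f u)%N by apply: kmin; exists q, u.
  case/eqP: uv; apply: ra; rewrite /r fv fu; exact: ku.
move: pu lt => /(leader_uniq hr pv) vu; rewrite -vu dv ltnNge => /negP; apply.
by apply: emin; exists q, v; split=> //; rewrite vu.
Qed.

(** Each element has minimal rank among the elements of P reduced with respect to its
    predecessors. *)
Let greedy s := [/\ autoreduced r s, forall p, p \in s -> P p &
  forall i, (i < size s)%N -> forall q, P q ->
    (forall p, p \in take i s -> reduced r q p) -> ~ lower_rank r q s`_i].

Let reducible s p := [/\ P p, exists v, leader r p v &
  forall q, q \in s -> reduced r p q].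

(** If [t] is lower than [s], its element at the deciding position is reduced with respect to the
    preceding elements of [s], as ranks agree there. It contradicts minimality at that position or,
    if [s] has ended, the absence of further reduced elements. *)
Let greedy_char_set s : greedy s -> (forall p, ~ reducible s p) -> char_set r P s.
Proof.
move=> [sa sP sg] nored; split=> // t ta tP /lower_set_first[i [it si sm lo]].
have [tl tr _] := ta; have tiP : t`_i \in t by apply: mem_nth.
have ti_red p : p \in take i s -> reduced r t`_i p.
  move=> pt; have [k ki <-] : exists2 k, (k < i)%N & s`_k = p.
    move/nthP: (pt) => /(_ 0)[k]; rewrite size_takel // => ki; rewrite nth_take //.
    by exists k.
  have kt : (k < size t)%N := ltn_trans ki it.
  apply: (reduced_same_rank hr (sm k ki)); apply: tr => //; first exact: mem_nth.
  by apply: (autoreduced_neq hr ta) => //; rewrite gtn_eqF.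
have [is_|is_] := ltnP i (size s).
  by apply: (sg i is_ t`_i (tP _ tiP) ti_red); apply: lo.
apply: (nored t`_i); split; [exact: tP | exact: tl |].
by move=> q qs; apply: ti_red; rewrite take_oversize.
Qed.

Let greedy_rcons s : greedy s -> (exists p, reducible s p) ->
  exists p, greedy (rcons s p).
Proof.
have [rt ra _ _ _] := hr.
move=> [sa sP sg] exp.
have [|p [Pp [v pv] pred] pmin] := min_rank exp; first by move=> p [].
exists p; split.
- apply: (autoreduced_rcons hr sa pv pred) => q u qs qu.
  (* The new element was already a candidate when q was chosen; this forces its leader above that of
     q. *)
  have nlow : ~ lower_rank r p q.
    rewrite -(nth_index 0 qs); apply: sg; rewrite ?index_mem // => p' p't.
    by apply: pred; apply: mem_take p't.
  have uv : u != v.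
    apply/eqP => uv; subst u; apply: nlow; right; exists v; split=> //.
    by case: v pv qu => j k pv qu; case: (pred q qs j k qu).
  split=> //; case/orP: (rt u v) => // vu; case: nlow; left; exists v, u.
  by rewrite eq_sym.
- by move=> q; rewrite mem_rcons inE => /predU1P[->//|/sP].
- move=> i; rewrite size_rcons ltnS leq_eqVlt => /predU1P[->|is_] q Pq qred.
    rewrite nth_rcons ltnn eqxx => low; apply: (pmin q) (low); split=> //.
      by case: low => [[u [v' [qu _ _ _]]]|[u [qu _ _]]]; exists u.
    by move=> p' p's; apply: qred; rewrite -cats1 take_size_cat.
  rewrite nth_rcons is_; apply: sg => // p' p't; apply: qred.
  by rewrite -cats1 takel_cat // ltnW.
Qed.

Lemma char_set_exists : exists s, char_set r P s.
Proof.
(* The greedy extension stops because an autoreduced set has at most [n.+1] elements; [d] bounds the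
   remaining steps. *)
suff H d s : greedy s -> (n.+2 - size s <= d)%N -> exists s', char_set r P s'.
  apply: (H n.+2 [::]); last by rewrite leq_subr.
  by split=> //; split=> // i j; rewrite ltn0 andbF.
elim: d s => [|d IH] s gs.
  have [sa _ _] := gs; rewrite leqn0 subn_eq0 => ns.
  by have := leq_trans ns (autoreduced_size hr sa); rewrite ltnn.
move=> ds; have [ex|nex] := EM (exists p, reducible s p).
  have [p gp] := greedy_rcons gs ex; apply: (IH _ gp).
  by rewrite size_rcons subnS -subn1 leq_subLR add1n.
by exists s; apply: greedy_char_set => // p sp; apply: nex; exists p.
Qed.
End CharSetExists.

(** * Orders of characteristic sets as bases *)

Section BasisOrders.
Context (F : fieldType) (n : nat) (P : diffpoly F n -> Prop).
Hypothesis hchar : [pchar F]%R =i pred0.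
Context (K : fieldType) (phi : {rmorphism diffpoly F n -> K}).
Hypothesis phiP : forall p, phi p = 0 <-> P p.
Local Notation cl := (cl (@dX F n) (dC n) phi).
Local Notation basis := (basis P phi).
Hypothesis cl_dnext : forall (B : dvar n -> Prop) v, cl B v ->
  cl (fun u => B u \/ exists2 w, B w & u = dnext w) (dnext v).

(** Differentiating a member of the box gives another member or some x_l^(o_l), so the closure is
    stable under derivation. *)
Lemma cl_box_all (o : 'I_n -> nat) : (forall j, cl (box o) (j, o j)) ->
  forall v, cl (box o) v.
Proof.
move=> oo [j k]; elim: k => [|k IH].
  case: (posnP (o j)) => [e|o0]; last exact: cl_in.
  by have := oo j; rewrite e.
apply: cl_trans (cl_dnext IH) _ => u [?|[[l i] wo ->]]; first exact: cl_in.
move: wo; rewrite /box /= leq_eqVlt => /predU1P[ko|ko].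
  by rewrite /dnext /= ko.
exact: cl_in.
Qed.

Lemma orders_basis (o : n.-tuple nat) : orders P o -> basis (tnth o).
Proof.
move=> [r [hr [A [[s [cs sA]] Al Ao]]]].
have Al' j : leader r (A j) (j, tnth o j).
  by have [k Ak] := Al j; rewrite Ao (leader_ordx hr Ak).
split; first exact: (char_set_free phiP hr cs sA Al').
apply: cl_box_all => j.
exact: (char_set_leaders_cl hchar phiP hr cs sA Al').
Qed.

Lemma basis_orders (o : n.-tuple nat) : basis (tnth o) -> orders P o.
Proof.
move=> [fo clo]; pose N := (\sum_j tnth o j)%N.
have oN j : (tnth o j <= N)%N by rewrite /N (bigD1 j) //= leq_addr.
(* The main term is k - o_j, shifted by [N] to stay a natural number; the index j is the remainder
   modulo n and breaks ties. *)
pose f (v : dvar n) := ((v.2 + (N - tnth o v.1)) * n + v.1)%N.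
pose r : rel (dvar n) := fun u v => (f u <= f v)%N.
have fdiv v : (f v %/ n = v.2 + (N - tnth o v.1))%N.
  by rewrite /f divnMDl ?divn_small ?addn0 // (leq_ltn_trans _ (ltn_ord v.1)).
have fmod v : (f v %% n = v.1)%N by rewrite /f modnMDl modn_small.
have fdnext v : f (dnext v) = (f v + n)%N by rewrite /f /= addSn mulSn -addnA addnC.
have hr : ranking r.
  split=> [u v|u v /anti_leq e|v u w|v|u v].
  - exact: leq_total.
  - have e1 : u.1 = v.1 by apply: val_inj; rewrite /= -!fmod e.
    have e2 : u.2 = v.2.
      by have := fdiv u; rewrite e fdiv e1 => /addIn.
    by case: u v e1 e2 {e} => [? ?] [? ?] /= -> ->.
  - exact: leq_trans.
  - by rewrite /r fdnext leq_addr.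
  - by rewrite /r !fdnext leq_add2r.
have [s cs] := char_set_exists P hr; have [sa sP _] := cs; have [sl sr _] := sa.
(* If the leader were inside the box, all variables of q would have weight below [N], hence lie in
   the box, and freeness would give q = 0. *)
have low q l k : q \in s -> leader r q (l, k) -> (tnth o l <= k)%N.
  move=> qs ql; rewrite leqNgt; apply/negP => ko.
  have q0 : q = 0.
    apply: (fo q (sP q qs)) => -[j i] /(leader_max ql) fji; rewrite /box /=.
    have := leq_div2r n fji; rewrite !fdiv /= => le.
    have : (i + (N - tnth o j) < N)%N.
      by apply: leq_ltn_trans le _; move: (oN l) ko; clear; lia.
    by move: (oN j); clear; lia.
  by move: (leader_in ql); rewrite q0 /dvars msupp0 big_seq_fset0 inE.
(* The derivatives below all leaders in their own variable, including every derivative of a variable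
   without leader; polynomials in them are reduced, so this set is free. *)
pose B (v : dvar n) := forall q k, q \in s -> leader r q (v.1, k) -> (v.2 < k)%N.
have fB : free P B.
  move=> p Pp pB; apply: (char_set_reduced phiP hr cs Pp) => q qs j k qjk.
  have nin l : (k <= l)%N -> (j, l) \notin dvars p.
    by move=> kl; apply/negP => /pB/(_ q k qs qjk); rewrite ltnNge /= kl.
  exact: notin_reduced qjk nin.
have oB v : box (tnth o) v -> B v.
  by case: v => j k ko q l qs ql; apply: leq_trans ko (low q j l qs ql).
(* Otherwise x_j^(o_j) would join the box inside the free set [B], although it lies in the closure
   of the box. *)
have ex j : exists q, q \in s /\ leader r q (j, tnth o j).
  apply: contrapT => nex.
  have jB : B (j, tnth o j).
    move=> q k qs qk; rewrite ltn_neqAle (low q j k qs qk) andbT /=.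
    by apply/eqP => e; apply: nex; exists q; rewrite e.
  have [E Et Ex] := free_extend hchar phiP (fun v => (v == (j, tnth o j))%:R) fB.
  have : E (dX F (j, tnth o j)) = 0.
    apply: clo => // w wo; rewrite Ex; last exact: oB.
    case: (eqVneq w (j, tnth o j)) => // wj; move: wo.
    by rewrite wj /box /= ltnn.
  by rewrite Ex // eqxx mulr1n => /eqP; rewrite oner_eq0.
have [A AP] := choice ex.
exists r; split=> //; exists A; split.
- exists s; split=> //; apply: uniq_perm; first exact: (autoreduced_uniq hr sa).
    rewrite map_inj_uniq ?enum_uniq // => j k e.
    have [_ Aj] := AP j; have [_ Ak] := AP k; move: Aj.
    by rewrite e => /(leader_uniq hr Ak)[->].
  move=> q; apply/idP/codomP => [qs|[j ->]]; last by case: (AP j).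
  have [[j k] qk] := sl q qs; exists j; have [As Aj] := AP j.
  exact: (autoreduced_leader_inj sa qs As qk Aj).
- by move=> j; exists (tnth o j); case: (AP j).
- by move=> j; have [_ Aj] := AP j; rewrite (leader_ordx hr Aj).
Qed.
End BasisOrders.

(** * Trading derivatives of one variable for another *)

Section Push.
Context (F : fieldType) (n : nat) (K : fieldType).
Context (phi : {rmorphism diffpoly F n -> K}).
Local Notation cl := (cl (@dX F n) (dC n) phi).
Hypothesis cl_dnext : forall (B : dvar n -> Prop) v, cl B v ->
  cl (fun u => B u \/ exists2 w, B w & u = dnext w) (dnext v).
Implicit Types (o : 'I_n -> nat) (p q l : 'I_n).

Definition raise o q k : 'I_n -> nat :=
  fun j => if j == q then (o j + k)%N else o j.

Lemma cl_push o p q : p != q -> cl (box (raise o q 1)) (p, o p) ->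
  (forall l, l != p -> l != q ->
     o l = 0%N \/ cl (box (raise (raise o p 1) q 1)) (l, o l)) ->
  forall i, cl (box (raise o q i.+1)) (p, (o p + i)%N).
Proof.
move=> pq clp cll; elim=> [|i IH]; first by rewrite addn0.
have up i' j v : (i' <= j)%N -> box (raise o q i') v -> box (raise o q j) v.
  rewrite /box /raise; case: ifP => _ ij vi //; apply: leq_trans vi _.
  by rewrite leq_add2l.
have clp' : cl (box (raise o q i.+2)) (p, o p).
  by apply: cl_sub clp _ => v; apply: up.
rewrite addnS; apply: cl_trans (cl_dnext IH) _ => u [Bu|].
  by apply: cl_in; apply: up Bu.
case=> -[l k] Bw ->; rewrite /dnext /=; move: Bw; rewrite /box /raise /=.
have [->|lq] := eqVneq l q.
  by move=> kq; apply: cl_in; rewrite /box /raise /= eqxx addnS ltnS.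
rewrite leq_eqVlt => /predU1P[ko|kl]; last first.
  by apply: cl_in; rewrite /box /raise /= (negPf lq).
rewrite ko; have [->|lp] := eqVneq l p; first exact: clp'.
have [o0|clo] := cll l lp lq; first by rewrite o0 in ko.
apply: cl_trans clo _ => -[m k'] Bm.
have [mp|mp] := eqVneq m p; last first.
  apply: cl_in; apply: (up 1%N) => //; move: Bm; rewrite /box /raise /=.
  by rewrite (negPf mp).
subst m; move: Bm; rewrite /box /raise /= (negPf pq) eqxx addn1 ltnS leq_eqVlt.
case/predU1P=> [->//|k'p]; apply: cl_in.
by rewrite /box /raise /= (negPf pq).
Qed.

(** The exchange property turns a dependence of x_q^(o_q) that really uses x_p^(o_p) into the one
    that [cl_push] differentiates. *)
Lemma cl_exchange_push o p q : p != q ->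
  cl (box (raise o p 1)) (q, o q) -> ~ cl (box o) (q, o q) ->
  (forall l, l != p -> l != q ->
     o l = 0%N \/ cl (box (raise (raise o p 1) q 1)) (l, o l)) ->
  forall i, cl (box (raise o q i.+1)) (p, (o p + i)%N).
Proof.
move=> pq clq nclq; apply: cl_push => //.
have raise1 j v : box (raise o j 1) v <-> box o v \/ v = (j, o j).
  case: v => l k; rewrite /box /raise /=; have [->|lj] := eqVneq l j.
    rewrite addn1 ltnS leq_eqVlt.
    split=> [/predU1P[->|]|[->|[->]]]; rewrite ?eqxx ?orbT //; by [right|left].
  by split=> [|[//|[/eqP]]]; [left | rewrite (negPf lj)].
have := cl_exchange (w := (p, o p)) _ nclq; move=> h.
apply: cl_sub (h _) _ => [|v /raise1//].
by apply: cl_sub clq _ => v /raise1.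
Qed.
End Push.

(** * Three variables: minimal dependences and the exchange of derivatives *)

Section Three.
Context (F : fieldType) (P : diffpoly F 3 -> Prop).
Hypothesis hchar : [pchar F]%R =i pred0.
Context (K : fieldType) (phi : {rmorphism diffpoly F 3 -> K}).
Hypothesis phiP : forall p, phi p = 0 <-> P p.
Local Notation cl := (cl (@dX F 3) (dC 3) phi).
Hypothesis cl_dnext : forall (B : dvar 3 -> Prop) v, cl B v ->
  cl (fun u => B u \/ exists2 w, B w & u = dnext w) (dnext v).

Let i0 : 'I_3 := @Ordinal 3 0 isT.
Let i1 : 'I_3 := @Ordinal 3 1 isT.
Let i2 : 'I_3 := @Ordinal 3 2 isT.
Let o3 x y z : 'I_3 -> nat := tnth [tuple x; y; z].

Let basis3 x y z := basis P phi (o3 x y z).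

Let box3P x y z v : box (o3 x y z) v <->
  [\/ v.1 = i0 /\ (v.2 < x)%N, v.1 = i1 /\ (v.2 < y)%N | v.1 = i2 /\ (v.2 < z)%N].
Proof.
case: v => -[[|[|[|//]]] hj] k; rewrite /box /o3 (tnth_nth 0%N) /=.
- have -> : Ordinal hj = i0 by apply: val_inj.
  by split=> [|[[]|[]|[]]] //; constructor 1.
- have -> : Ordinal hj = i1 by apply: val_inj.
  by split=> [|[[]|[]|[]]] //; constructor 2.
- have -> : Ordinal hj = i2 by apply: val_inj.
  by split=> [|[[]|[]|[]]] //; constructor 3.
Qed.

Let box3_sub x y z x' y' z' v : (x <= x')%N -> (y <= y')%N -> (z <= z')%N ->
  box (o3 x y z) v -> box (o3 x' y' z') v.
Proof.
move=> xx yy zz /box3P h; apply/box3P.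
case: h => -[v1 v2]; [constructor 1|constructor 2|constructor 3]; split=> //;
  exact: leq_trans v2 _.
Qed.

Let o3_0 x y z : o3 x y z i0 = x. Proof. by []. Qed.
Let o3_1 x y z : o3 x y z i1 = y. Proof. by []. Qed.
Let o3_2 x y z : o3 x y z i2 = z. Proof. by []. Qed.

Let raise0 x y z k : raise (o3 x y z) i0 k = o3 (x + k) y z.
Proof.
by apply: funext => -[[|[|[|//]]] hj]; rewrite /raise /o3 !(tnth_nth 0%N).
Qed.

Let raise1 x y z k : raise (o3 x y z) i1 k = o3 x (y + k) z.
Proof.
by apply: funext => -[[|[|[|//]]] hj]; rewrite /raise /o3 !(tnth_nth 0%N).
Qed.

Let raise2 x y z k : raise (o3 x y z) i2 k = o3 x y (z + k).
Proof.
by apply: funext => -[[|[|[|//]]] hj]; rewrite /raise /o3 !(tnth_nth 0%N).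
Qed.


Let cl_le x y z x' y' z' v : cl (box (o3 x y z)) v ->
  (x <= x')%N -> (y <= y')%N -> (z <= z')%N -> cl (box (o3 x' y' z')) v.
Proof. by move=> clv xx yy zz; apply: cl_sub clv _ => u; apply: box3_sub. Qed.

(** By [basis_card], only the derivatives that leave the old box have to be recovered, provided the
    totals agree. *)
Let basis3_exchange x y z x' y' z' : basis3 x y z ->
  (forall k, (x' <= k < x)%N -> cl (box (o3 x' y' z')) (i0, k)) ->
  (forall k, (y' <= k < y)%N -> cl (box (o3 x' y' z')) (i1, k)) ->
  (forall k, (z' <= k < z)%N -> cl (box (o3 x' y' z')) (i2, k)) ->
  (x + y + z = x' + y' + z')%N -> basis3 x' y' z'.
Proof.
move=> bxyz cx cy cz e; have [_ spans] := bxyz.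
apply: (basis_card hchar phiP bxyz).
  move=> v; apply: cl_trans (spans v) _ => -[j k] /box3P.
  case=> -[/= -> kk].
  - have [k'|k'] := leqP x' k; first by apply: cx; rewrite k'.
    by apply: cl_in; apply/box3P; constructor 1.
  - have [k'|k'] := leqP y' k; first by apply: cy; rewrite k'.
    by apply: cl_in; apply/box3P; constructor 2.
  - have [k'|k'] := leqP z' k; first by apply: cz; rewrite k'.
    by apply: cl_in; apply/box3P; constructor 3.
by rewrite !big_ord_recl !big_ord0 /o3 !(tnth_nth 0%N) /= !addn0 !addnA.
Qed.

Lemma orders3 x y z : orders P [tuple x; y; z] <-> basis3 x y z.
Proof.
split; first exact: (orders_basis hchar phiP cl_dnext).
exact: (basis_orders hchar phiP).
Qed.

Lemma basis_notin o B w : basis P phi o -> box o w ->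
  (forall v, B v -> box o v /\ v != w) -> ~ cl B w.
Proof.
move=> [fo _] ow Bo clw.
have [E Et Ex] := free_extend hchar phiP (fun v => (v == w)%:R) fo.
have: E (dX F w) = 0.
  by apply: clw => // v /Bo[ov vw]; rewrite Ex // (negPf vw).
by rewrite Ex // eqxx mulr1n => /eqP; rewrite oner_eq0.
Qed.

Variables a1 a2 a3 b c : nat.
Hypotheses (hba : (b < a1)%N) (hcb : (c < b)%N).
Hypotheses (ha1 : basis3 a1 a2 a3) (ha2 : basis3 b (a2 + a1 - b) a3).
Hypothesis ha3 : basis3 c a2 (a3 + a1 - c).
Hypothesis ha5 : forall d1 d3, (c < d1 < a1)%N -> ~ basis3 d1 a2 d3.
Hypothesis hc1 : forall e2 e3, (e2 < a2)%N -> ~ basis3 a1 e2 e3.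
Hypothesis hc2 : forall f1 f2, (f2 < a2)%N -> ~ basis3 f1 f2 a3.

(* Hence the derivatives of x_1 and x_3 generate a differential subfield. *)
Let x3_in_closure : cl (box (o3 a1 0 a3)) (i2, a3).
Proof.
(* [k1] and [k3] are the least numbers of derivatives of x_2 needed for x_1^(a1) and x_3^(a3); the
   claim is that [k3] is 0. *)
have [k1 ck1 min1] : exists2 k, cl (box (o3 a1 k a3)) (i0, a1) &
    forall l, cl (box (o3 a1 l a3)) (i0, a1) -> (k <= l)%N.
  by apply: ex_min_nat; exists a2; case: ha1.
have [k3 ck3 min3] : exists2 k, cl (box (o3 a1 k a3)) (i2, a3) &
    forall l, cl (box (o3 a1 l a3)) (i2, a3) -> (k <= l)%N.
  by apply: ex_min_nat; exists a2; case: ha1.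
have k1a : (k1 <= a2)%N by apply: min1; case: ha1.
have k3a : (k3 <= a2)%N by apply: min3; case: ha1.
have [k13|k31] := leqP k1 k3.
  (* If k3 = k + 1 is at least [k1], then x_2^(k), .., x_2^(a2-1) are traded for derivatives of x_3,
     and the basis (a1, k, a3 + a2 - k) contradicts [hc1]. *)
  case: k3 ck3 min3 k3a k13 => [//|k] ck3 min3 ka k1k; exfalso.
  have nck : ~ cl (box (o3 a1 k a3)) (i2, a3) by move/min3; rewrite ltnn.
  have push := @cl_exchange_push _ _ _ phi cl_dnext (o3 a1 k a3) i1 i2 isT.
  rewrite raise1 o3_1 o3_2 addn1 in push.
  have {}push : forall i, cl (box (o3 a1 k (a3 + i.+1))) (i1, (k + i)%N).
    move=> i; rewrite -raise2; apply: push => // -[[|[|[|//]]] hl] // _ _; right.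
    rewrite raise2 addn1.
    have -> : Ordinal hl = i0 by apply: val_inj.
    by rewrite o3_0; apply: cl_le ck1 _ _ _; rewrite ?leq_addr.
  apply: (hc1 (e3 := (a3 + (a2 - k))%N) ka).
  apply: (basis3_exchange ha1) => [l|l|l|].
  - by move=> /andP[h1 h2]; lia.
  - move=> /andP[kl la]; have := push (l - k)%N; rewrite subnKC // => cll.
    by apply: cl_le cll _ _ _ => //; lia.
  - by move=> /andP[h1 h2]; lia.
  - by lia.
(* Symmetrically, if k1 = k + 1 exceeds [k3], the trade is for derivatives of x_1, and (a1 + a2 - k,
   k, a3) contradicts [hc2]. *)
case: k1 ck1 min1 k1a k31 => [//|k] ck1 min1 ka k3k; exfalso.
have nck : ~ cl (box (o3 a1 k a3)) (i0, a1) by move/min1; rewrite ltnn.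
have push := @cl_exchange_push _ _ _ phi cl_dnext (o3 a1 k a3) i1 i0 isT.
rewrite raise1 o3_1 o3_0 addn1 in push.
have {}push : forall i, cl (box (o3 (a1 + i.+1) k a3)) (i1, (k + i)%N).
  move=> i; rewrite -raise0; apply: push => // -[[|[|[|//]]] hl] // _ _; right.
  rewrite raise0.
  have -> : Ordinal hl = i2 by apply: val_inj.
  by rewrite o3_2; apply: cl_le ck3 _ _ _; rewrite ?leq_addr // ltnW.
apply: (hc2 (f1 := (a1 + (a2 - k))%N) ka).
apply: (basis3_exchange ha1) => [l|l|l|].
- by move=> /andP[h1 h2]; lia.
- move=> /andP[kl la]; have := push (l - k)%N; rewrite subnKC // => cll.
  by apply: cl_le cll _ _ _ => //; lia.
- by move=> /andP[h1 h2]; lia.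
- by lia.
Qed.

Let x1_in_closure i : cl (box (o3 c 0 (a3 + i.+1))) (i0, (c + i)%N).
Proof.
have [k ck kmin] : exists2 k, cl (box (o3 k 0 a3)) (i2, a3) &
    forall l, cl (box (o3 l 0 a3)) (i2, a3) -> (k <= l)%N.
  by apply: ex_min_nat; exists a1; apply: x3_in_closure.
have ka : (k <= a1)%N by apply: kmin; apply: x3_in_closure.
(* In the basis (c, a2, a3 + a1 - c) the element x_3^(a3) is independent of the others, so c
   derivatives of x_1 do not suffice. *)
have ck' : (c < k)%N.
  rewrite ltnNge; apply/negP => kc.
  apply: (basis_notin (B := box (o3 k 0 a3)) ha3) ck.
    by apply/box3P; constructor 3; split=> //=; lia.
  move=> v vB; split; first by apply: box3_sub vB => //; lia.
  apply/eqP => vE; subst v; case/box3P: vB => -[] //=.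
  by rewrite ltnn.
case: k ck kmin ka ck' => [//|k] ck kmin ka ck'.
have nck : ~ cl (box (o3 k 0 a3)) (i2, a3) by move/kmin; rewrite ltnn.
have push := @cl_exchange_push _ _ _ phi cl_dnext (o3 k 0 a3) i0 i2 isT.
rewrite raise0 o3_0 o3_2 addn1 in push.
have {}push : forall i, cl (box (o3 k 0 (a3 + i.+1))) (i0, (k + i)%N).
  move=> j; rewrite -raise2; apply: push => // -[[|[|[|//]]] hl] // _ _; left.
  by rewrite /o3 (tnth_nth 0%N).
(* After the predecessor is taken, x_1^(k) is the highest derivative needed; if k > c, the trade
   gives the basis (k, a2, a3 + a1 - k), excluded by [ha5]. *)
have kc : k = c.
  apply/eqP; rewrite eqn_leq -[(c <= k)%N]ltnS ck' andbT leqNgt; apply/negP => ck''.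
  apply: (ha5 (d1 := k) (d3 := (a3 + (a1 - k))%N)); first by rewrite ck''.
  apply: (basis3_exchange ha1) => [l|l|l|].
  - move=> /andP[kl la]; have := push (l - k)%N; rewrite subnKC // => cll.
    by apply: cl_le cll _ _ _ => //; lia.
  - by move=> /andP[h1 h2]; lia.
  - by move=> /andP[h1 h2]; lia.
  - by lia.
by rewrite -kc.
Qed.

Lemma basis_target : basis3 c (a2 + a1 - b) (a3 + b - c).
Proof.
apply: (basis3_exchange ha2) => [l|l|l|].
- move=> /andP[cl0 lb]; have := @x1_in_closure (l - c)%N; rewrite subnKC // => cll.
  by apply: cl_le cll _ _ _ => //; lia.
- by move=> /andP[h1 h2]; lia.
- by move=> /andP[h1 h2]; lia.
- by lia.
Qed.
End Three.

(* Passage from orders to bases for the given prime differential ideal *)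
Close Scope ring_scope.
Close Scope ring_scope.
Close Scope fset_scope.

Theorem proposition152 (F : fieldType) (delta : F -> F)
    (hdelta : derivation delta) (hchar : [pchar F]%R =i pred0)
    (P : diffpoly F 3 -> Prop)
    (hP : prime_diff_ideal delta P) (hdim : diff_dim P 0)
    (a1 a2 a3 b c : nat) (hba : b < a1) (hcb : c < b)
    (ha1 : orders P [tuple a1; a2; a3])
    (ha2 : orders P [tuple b; a2 + a1 - b; a3])
    (ha3 : orders P [tuple c; a2; a3 + a1 - c])
    (ha4 : ~ exists d1 d2, b < d1 < a1 /\ orders P [tuple d1; d2; a3])
    (ha5 : ~ exists d1 d3, c < d1 < a1 /\ orders P [tuple d1; a2; d3])
    (hb : ~ exists d1 d2, c <= d1 < b /\ orders P [tuple d1; d2; a3])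
    (hc1 : ~ exists e2 e3, e2 < a2 /\ orders P [tuple a1; e2; e3])
    (hc2 : ~ exists f1 f2, f2 < a2 /\ orders P [tuple f1; f2; a3]) :
  orders P [tuple c; a2 + a1 - b; a3 + b - c].
Proof.
have [[P0 PD PM Pd] P1 Pprime] := hP.
have [K [phi [phiP frac]]] := prime_residue_field P0 PD PM P1 Pprime.
(* Stability of P under derivation lets the derivation descend to [K], which makes the closure
   compatible with it. *)
have D_ker p : phi p = 0%R -> phi (dpoly delta p) = 0%R.
  by move=> /phiP/Pd/phiP.
have [d [dD dM dphi]] :=
  derivation_on_fractions (dpolyD hdelta) (dpolyM hdelta) D_ker frac.
have cl_dnext (B : dvar 3 -> Prop) v : cl (@dX F 3) (dC 3) phi B v ->
    cl (@dX F 3) (dC 3) phi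
      (fun u => B u \/ exists2 w, B w & u = dnext w) (dnext v).
  move=> Bv.
  exact: (@cl_shift _ _ _ _ (@dX F 3) (dC 3) phi (dpoly delta) d (@dnext 3) delta
    (dpolyD hdelta) (dpolyM hdelta) (dpolyC 3 hdelta) (dpolyX hdelta)
    dD dM dphi B v Bv).
have ordersP x y z := orders3 hchar phiP cl_dnext x y z.
apply/ordersP.
apply: (basis_target hchar phiP cl_dnext hba hcb).
- exact/ordersP.
- exact/ordersP.
- exact/ordersP.
- by move=> d1 d3 d1P /ordersP od; apply: ha5; exists d1, d3.
- by move=> e2 e3 e2P /ordersP oe; apply: hc1; exists e2, e3.
- by move=> f1 f2 f2P /ordersP of_; apply: hc2; exists f1, f2.
Qed.
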